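(* Let $y=\sqrt{1-4t}$, regarded as the formal power series in $t$ with constant term $1$. Then, as formal power series in $t$ with coefficients polynomial in $x_1,x_2,x_3$, the generating function of three-rooted plane trees $G_3(t,x_1,x_2,x_3)=\sum_{d_1,d_2,d_3\ge 0}\sum_{e\ge0}T_3(e;d_1,d_2,d_3)\,x_1^{d_1}x_2^{d_2}x_3^{d_3}t^e$ is $$G_3(t,x_1,x_2,x_3) = \frac{ t^2 \, x_1 \, x_2 \, x_3 \, (y+1)^{10}}{2 \, y^3 \, (1+y-2t x_1)^3 \, (1+y-2tx_2)^3 \, (1+y-2t x_3)^3} \Bigl( 1-y + (2y-2t) (x_1+x_2+x_3) + \tfrac{1}{2} (y-1)(1+3y-6t) (x_1 x_2 + x_1 x_3 + x_2 x_3) + \tfrac{1}{4} (y-1)^2 (2+4y-10t)\, x_1 x_2 x_3 \Bigr).$$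
   Context: A plane tree with $e\ge1$ edges is a triple $\Gamma=(H,\alpha,\sigma)$, where $H$ is a set of $2e$ half-edges and $\alpha,\sigma$ are permutations of $H$ such that $\alpha$ is a fixed-point-free involution, the group generated by $\alpha,\sigma$ acts transitively on $H$, and $\sigma$ has exactly $e+1$ cycles (fixed points counted as cycles). Cycles of $\alpha$ are the edges, cycles of $\sigma$ are the vertices (with the cyclic order of half-edges around them), and the degree of a vertex is the length of its cycle. A three-rooted tree is a plane tree together with three distinct half-edges (first, second and third root) belonging to three distinct cycles of $\sigma$; the corresponding vertices are labeled $v_1,v_2,v_3$. An isomorphism of three-rooted trees $(H,\alpha,\sigma)\to(H',\alpha',\sigma')$ is a bijection $\varphi:H\to H'$ with $\alpha=\varphi^{-1}\alpha'\varphi$, $\sigma=\varphi^{-1}\sigma'\varphi$, sending the $k$th root to the $k$th root for $k=1,2,3$. Isomorphic trees are identified. $T_3(e;d_1,d_2,d_3)$ is the number of three-rooted trees with $e$ edges in which $v_j$ has degree $d_j$ for $j=1,2,3$; there are none with $e=0$. *)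

(* Defs.v *)
From HB Require Import structures.
From mathcomp Require Import all_boot all_order all_algebra all_fingroup.
From mathcomp Require Import boolp.
From mathcomp Require Import mpoly ring.

Set Implicit Arguments.
Unset Strict Implicit.
Unset Printing Implicit Defensive.

Import GRing.Theory.
Local Open Scope ring_scope.

(* Formal power series, with the Cauchy product. A series is invertible iff   *)
(* its constant term is; as for any unitRingType, inverting a non-invertible  *)
(* series returns it unchanged.                                               *)

Record fps (R : Type) := Fps { fps_coef :> nat -> R }.

Notation "{ 'fps' R }" := (fps R) (at level 0, format "{ 'fps'  R }").
Notation "\fps_ n E" := (Fps (fun n => E))
  (at level 36, n name, E at level 36, format "\fps_ n  E").

Lemma fpsP (R : Type) (f g : {fps R}) : f =1 g <-> f = g.
Proof.
split=> [|-> //]; case: f g => [f] [g] /= fg.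
by congr Fps; apply/funext.
Qed.

HB.instance Definition _ (R : Type) := gen_eqMixin {fps R}.
HB.instance Definition _ (R : Type) := gen_choiceMixin {fps R}.

Section FpsZmodule.
Variable R : zmodType.
Implicit Types f g h : {fps R}.

Definition fps_zero : {fps R} := Fps (fun=> 0).
Definition fps_opp f : {fps R} := \fps_n (- f n).
Definition fps_add f g : {fps R} := \fps_n (f n + g n).

Fact fps_addA : associative fps_add.
Proof. by move=> f g h; apply/fpsP => n /=; rewrite addrA. Qed.
Fact fps_addC : commutative fps_add.
Proof. by move=> f g; apply/fpsP => n /=; rewrite addrC. Qed.
Fact fps_add0 : left_id fps_zero fps_add.
Proof. by move=> f; apply/fpsP => n /=; rewrite add0r. Qed.
Fact fps_addN : left_inverse fps_zero fps_opp fps_add.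
Proof. by move=> f; apply/fpsP => n /=; rewrite addNr. Qed.

HB.instance Definition _ :=
  GRing.isZmodule.Build {fps R} fps_addA fps_addC fps_add0 fps_addN.

Lemma fps_coef0 n : (0 : {fps R}) n = 0. Proof. by []. Qed.
Lemma fps_coefN f n : (- f) n = - f n. Proof. by []. Qed.
Lemma fps_coefD f g n : (f + g) n = f n + g n. Proof. by []. Qed.
Lemma fps_coefB f g n : (f - g) n = f n - g n. Proof. by []. Qed.
Lemma fps_coef_sum I (r : seq I) (P : pred I) (F : I -> {fps R}) n :
  (\sum_(i <- r | P i) F i) n = \sum_(i <- r | P i) F i n.
Proof. by apply: (big_morph (fun f : {fps R} => f n)). Qed.

End FpsZmodule.

Definition fpsC (R : zmodType) (c : R) : {fps R} :=
  \fps_n (if n == 0%N then c else 0).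

Notation "c %:S" := (fpsC c) (at level 2, left associativity, format "c %:S").

Section FpsRing.
Variable R : comNzRingType.
Implicit Types f g h : {fps R}.

Definition fps_mul f g : {fps R} := \fps_n (\sum_(i < n.+1) f i * g (n - i)%N).

Let trunc f n : {poly R} := \poly_(i < n.+1) f i.

Let coef_trunc f n i : (i <= n)%N -> (trunc f n)`_i = f i.
Proof. by move=> le_in; rewrite coef_poly ltnS le_in. Qed.

Let fps_mulE f g n i : (i <= n)%N ->
  (fps_mul f g) i = (trunc f n * trunc g n)`_i.
Proof.
move=> le_in /=; rewrite coefM; apply: eq_bigr => j _.
rewrite !coef_trunc //; first exact: leq_trans (leq_subr _ _) le_in.
by apply: leq_trans le_in; rewrite -ltnS.
Qed.

Let coefM_eq (p q p' q' : {poly R}) n :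
  (forall i, (i <= n)%N -> p`_i = p'`_i) ->
  (forall i, (i <= n)%N -> q`_i = q'`_i) -> (p * q)`_n = (p' * q')`_n.
Proof.
move=> pp' qq'; rewrite !coefM; apply: eq_bigr => j _.
by rewrite pp' ?qq' ?leq_subr // -ltnS.
Qed.

Fact fps_mulC : commutative fps_mul.
Proof.
by move=> f g; apply/fpsP => n; rewrite !(fps_mulE _ _ (leqnn n)) mulrC.
Qed.

Fact fps_mulA : associative fps_mul.
Proof.
move=> f g h; apply/fpsP => n; rewrite !(fps_mulE _ _ (leqnn n)).
transitivity ((trunc f n * (trunc g n * trunc h n))`_n).
  by apply: coefM_eq => // i le_in; rewrite coef_trunc // (fps_mulE _ _ le_in).
rewrite mulrA; apply: coefM_eq => // i le_in.
by rewrite coef_trunc // (fps_mulE _ _ le_in).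
Qed.

Fact fps_mul1 : left_id 1%:S fps_mul.
Proof.
move=> f; apply/fpsP => n /=; rewrite big_ord_recl /= mul1r subn0.
by rewrite big1 ?addr0 // => i _; rewrite mul0r.
Qed.

Fact fps_mulD : left_distributive fps_mul +%R.
Proof.
move=> f g h; apply/fpsP => n; rewrite fps_coefD /= -big_split /=.
by apply: eq_bigr => i _; rewrite mulrDl.
Qed.

Fact fps_oner_neq0 : (1%:S : {fps R}) != 0.
Proof.
by apply/eqP => /fpsP/(_ 0%N)/eqP; rewrite /= oner_eq0.
Qed.

HB.instance Definition _ := GRing.Zmodule_isComNzRing.Build {fps R}
  fps_mulA fps_mulC fps_mul1 fps_mulD fps_oner_neq0.

Lemma fps_coefC (c : R) n : c%:S n = if n == 0%N then c else 0.
Proof. by []. Qed.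
Lemma fps_coef1 n : (1 : {fps R}) n = (n == 0%N)%:R.
Proof. by rewrite [LHS]/=; case: eqP. Qed.
Lemma fps_coefM f g n : (f * g) n = \sum_(i < n.+1) f i * g (n - i)%N.
Proof. by []. Qed.
Lemma fps_coefM0 f g : (f * g) 0%N = f 0%N * g 0%N.
Proof. by rewrite fps_coefM big_ord_recl big_ord0 addr0. Qed.

Lemma fpsC_is_zmod_morphism : zmod_morphism (@fpsC R).
Proof.
by move=> a b; apply/fpsP => n; rewrite fps_coefB /=; case: eqP; rewrite ?subr0.
Qed.
HB.instance Definition _ := GRing.isZmodMorphism.Build R {fps R} (@fpsC R) fpsC_is_zmod_morphism.

Lemma fpsC_is_monoid_morphism : monoid_morphism (@fpsC R).
Proof.
split=> // a b; apply/fpsP => n; rewrite fps_coefM big_ord_recl /= subn0.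
rewrite big1 ?addr0 => [|i _]; last by rewrite mul0r.
by case: eqP => _; rewrite ?mulr0.
Qed.
HB.instance Definition _ :=
  GRing.isMonoidMorphism.Build R {fps R} (@fpsC R) fpsC_is_monoid_morphism.

Definition fpsX : {fps R} := \fps_n (n == 1%N)%:R.

Lemma fps_coefXM f n : (fpsX * f) n = if n is m.+1 then f m else 0.
Proof.
rewrite fps_coefM big_ord_recl /= mul0r add0r.
case: n => [|n]; first by rewrite big_ord0.
rewrite big_ord_recl /= mul1r subSS subn0 big1 ?addr0 // => i _.
by rewrite mul0r.
Qed.

Lemma fps_coef_exp_lt f k n : f 0%N = 0 -> (n < k)%N -> (f ^+ k) n = 0.
Proof.
move=> f0; elim: k n => // k IHk n; rewrite ltnS => le_nk.
rewrite exprS fps_coefM big_ord_recl f0 mul0r add0r big1 // => i _.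
rewrite IHk ?mulr0 //= /bump /= add1n.
case: n i le_nk => [[]|n i] // le_nk.
by rewrite subSS (leq_ltn_trans (leq_subr _ _)).
Qed.

End FpsRing.

Section FpsUnitRing.
Variable R : comUnitRingType.
Implicit Types f g : {fps R}.

Definition fps_unit : {pred {fps R}} := [pred f : {fps R} | f 0%N \is a GRing.unit].

(* If c is the constant term of f, the inverse of f is c^-1 * sum_k u ^ k     *)
(* with u = 1 - c^-1 * f, where u ^ k has no term of order less than k.       *)
Definition fps_inv f : {fps R} :=
  if f \in fps_unit then
    let c := (f 0%N)^-1 in
    c%:S * \fps_n (\sum_(k < n.+1) ((1 - c%:S * f) ^+ k) n)
  else f.

Fact fps_mulVr : {in fps_unit, left_inverse 1 fps_inv *%R}.
Proof.
move=> f fU; rewrite /fps_inv fU /=; set c := (f 0%N)^-1.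
set u := 1 - _; set s := Fps _.
have u0 : u 0%N = 0.
  by rewrite fps_coefB fps_coefM0 /= mulVr ?subrr.
have sE n m : (m <= n)%N -> s m = (\sum_(k < n.+1) u ^+ k) m.
  move=> le_mn; rewrite fps_coef_sum /= (big_ord_widen n.+1 (fun k => (u ^+ k) m)) //.
  rewrite big_mkcond /=; apply: eq_bigr => k _; case: ltnP => // lt_mk.
  by rewrite fps_coef_exp_lt.
have cfE : c%:S * f = 1 - u by rewrite opprB addrC subrK.
rewrite mulrAC cfE mulrC; apply/fpsP => n.
transitivity (((\sum_(k < n.+1) u ^+ k) * (1 - u)) n).
  rewrite !fps_coefM; apply: eq_bigr => i _.
  by rewrite (sE n) // -ltnS.
by rewrite mulrC -opprB mulNr -subrX1 opprB fps_coefB fps_coef_exp_lt ?subr0.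
Qed.

Fact fps_unitP f g : g * f = 1 -> f \in fps_unit.
Proof.
move=> /fpsP/(_ 0%N); rewrite fps_coefM0 => gf1.
by apply/unitrPr; exists (g 0%N); rewrite mulrC.
Qed.

Fact fps_inv_out : {in [predC fps_unit], fps_inv =1 id}.
Proof. by move=> f; rewrite inE /= /fps_inv => /negPf->. Qed.

HB.instance Definition _ := GRing.ComNzRing_hasMulInverse.Build {fps R}
  fps_mulVr fps_unitP fps_inv_out.

Lemma fps_unitE f : (f \is a GRing.unit) = (f 0%N \is a GRing.unit).
Proof. by []. Qed.

End FpsUnitRing.

(* A permutation sigma is read as a graph whose vertices are its cycles, and  *)
(* the degree of the vertex carrying h is #|porbit sigma h|.                  *)

Definition plane_tree (H : finType) (e : nat) (alpha sigma : {perm H}) : bool :=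
  [&& (0 < e)%N, #|H| == e.*2,
      [forall h, alpha (alpha h) == h], [forall h, alpha h != h],
      [transitive <<[set alpha; sigma]>>%g, on [set: H] | 'P]
    & #|porbits sigma| == e.+1].

Record rooted_map (H : finType) := RootedMap {
  edge_perm : {perm H};
  vertex_perm : {perm H};
  root1 : H;
  root2 : H;
  root3 : H
}.

Section RootedMapFinite.
Variable H : finType.

Let code (G : rooted_map H) : {perm H} * {perm H} * (H * H * H) :=
  let: RootedMap a s r1 r2 r3 := G in (a, s, (r1, r2, r3)).
Let decode (p : {perm H} * {perm H} * (H * H * H)) : rooted_map H :=
  let: (a, s, (r1, r2, r3)) := p in RootedMap a s r1 r2 r3.
Let codeK : cancel code decode. Proof. by case. Qed.

HB.instance Definition _ := Finite.copy (rooted_map H) (can_type codeK).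

End RootedMapFinite.

Definition root_vertices (H : finType) (G : rooted_map H) : seq {set H} :=
  [seq porbit (vertex_perm G) r | r <- [:: root1 G; root2 G; root3 G]].

Definition three_rooted_tree (H : finType) (e : nat) (G : rooted_map H) : bool :=
  plane_tree e (edge_perm G) (vertex_perm G) && uniq (root_vertices G).

Definition rooted_iso (H H' : finType)
    (G : rooted_map H) (G' : rooted_map H') : Prop :=
  exists2 phi : H -> H', bijective phi &
    [/\ forall h, phi (edge_perm G h) = edge_perm G' (phi h),
        forall h, phi (vertex_perm G h) = vertex_perm G' (phi h),
        phi (root1 G) = root1 G', phi (root2 G) = root2 G'
      & phi (root3 G) = root3 G'].

Lemma rooted_iso_refl (H : finType) (G : rooted_map H) : rooted_iso G G.
Proof. by exists id => //; exists id. Qed.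

Lemma rooted_iso_sym (H H' : finType) (G : rooted_map H) (G' : rooted_map H') :
  rooted_iso G G' -> rooted_iso G' G.
Proof.
case=> phi [psi phiK psiK] [pa ps p1 p2 p3].
exists psi; first by exists phi.
by split=> [h|h|||]; rewrite -?(p1, p2, p3) ?phiK //; apply: (can_inj phiK);
   rewrite ?pa ?ps !psiK.
Qed.

Lemma rooted_iso_trans (H1 H2 H3 : finType)
    (G1 : rooted_map H1) (G2 : rooted_map H2) (G3 : rooted_map H3) :
  rooted_iso G1 G2 -> rooted_iso G2 G3 -> rooted_iso G1 G3.
Proof.
case=> phi bphi [pa ps p1 p2 p3] [psi bpsi [qa qs q1 q2 q3]].
exists (psi \o phi); first exact: bij_comp.
by split=> [h|h|||] /=; rewrite ?(pa, ps, p1, p2, p3).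
Qed.

(* Any set of 2e half-edges is in bijection with 'I_(e.*2), so counting the   *)
(* isomorphism classes of trees on this set of half-edges is no restriction.  *)
Definition three_rooted_trees (e d1 d2 d3 : nat) : {set rooted_map 'I_(e.*2)} :=
  [set G | three_rooted_tree e G
         & map (fun V : {set 'I_(e.*2)} => #|V|) (root_vertices G)
             == [:: d1; d2; d3]].

Definition num_three_rooted_trees (e d1 d2 d3 : nat) : nat :=
  #|equivalence_partition
      (fun G G' : rooted_map 'I_(e.*2) => `[< rooted_iso G G' >])
      (three_rooted_trees e d1 d2 d3)|.

Lemma rooted_iso_equivalence (H : finType) (D : {set rooted_map H}) :
  {in D & &, equivalence_rel (fun G G' : rooted_map H => `[< rooted_iso G G' >])}.
Proof.
move=> G1 G2 G3 _ _ _; split; first exact/asboolP/rooted_iso_refl.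
move=> /asboolP iso12; apply/asboolP/asboolP => [|]; last exact: rooted_iso_trans.
exact/rooted_iso_trans/rooted_iso_sym.
Qed.

Lemma num_three_rooted_trees_eq0 (e d1 d2 d3 : nat) :
  ~~ [&& d1 <= e.*2, d2 <= e.*2 & d3 <= e.*2]%N ->
  num_three_rooted_trees e d1 d2 d3 = 0%N.
Proof.
move=> out; rewrite /num_three_rooted_trees.
suff -> : three_rooted_trees e d1 d2 d3 = set0.
  by apply/eqP; rewrite cards_eq0 /equivalence_partition imset0.
apply/setP => G; rewrite !inE; apply/negP => /andP[_ /eqP[d1E d2E d3E]].
case/negP: out; rewrite -d1E -d2E -d3E.
have le_card (A : {set 'I_(e.*2)}) : (#|A| <= e.*2)%N.
  by rewrite -[leqRHS]card_ord max_card.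
by rewrite !le_card.
Qed.

Definition x1 : {mpoly rat[3]} := 'X_(@Ordinal 3 0 isT).
Definition x2 : {mpoly rat[3]} := 'X_(@Ordinal 3 1 isT).
Definition x3 : {mpoly rat[3]} := 'X_(@Ordinal 3 2 isT).

(* The coefficient of t ^ e is a finite sum, as a vertex has degree at most   *)
(* the number 2e of half-edges; see mcoeff_gf_three_rooted.                   *)
Definition gf_three_rooted : {fps {mpoly rat[3]}} :=
  \fps_e \sum_(d1 < (e.*2).+1) \sum_(d2 < (e.*2).+1) \sum_(d3 < (e.*2).+1)
    (num_three_rooted_trees e d1 d2 d3)%:R *: (x1 ^+ d1 * x2 ^+ d2 * x3 ^+ d3).

Lemma mcoeff_gf_three_rooted (e : nat) (m : 'X_{1..3}) :
  (gf_three_rooted e)@_m =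
  (num_three_rooted_trees e (m (@Ordinal 3 0 isT)) (m (@Ordinal 3 1 isT))
     (m (@Ordinal 3 2 isT)))%:R.
Proof.
set a := m _; set b := m _; set c := m _.
have monE d1 d2 d3 : (x1 ^+ d1 * x2 ^+ d2 * x3 ^+ d3)@_m =
    [&& d1 == a, d2 == b & d3 == c]%:R :> rat.
  rewrite !mpolyXn -!mpolyXD mcoeffX; congr (_ : bool)%:R.
  apply/eqP/and3P => [mE|[/eqP d1E /eqP d2E /eqP d3E]].
    rewrite /a /b /c -mE !mnmDE !mulmnE !mnm1E /=.
    by rewrite !mul1n !mul0n !addn0 ?add0n.
  apply/mnmP => -[[|[|[|i]]] lt_i3] //; rewrite !mnmDE !mulmnE !mnm1E /=;
    rewrite !mul1n !mul0n !addn0 ?add0n ?(d1E, d2E, d3E);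
    by congr (m _); apply: val_inj.
rewrite /= !raddf_sum /=.
under eq_bigr => d1 _.
  rewrite raddf_sum /=; under eq_bigr => d2 _.
    rewrite raddf_sum /=; under eq_bigr => d3 _ do rewrite linearZ /= monE.
    over.
  over.
have [/and3P[ha hb hc]|/num_three_rooted_trees_eq0 T0] :=
    boolP [&& a <= e.*2, b <= e.*2 & c <= e.*2]%N; last first.
  rewrite T0 big1 // => d1 _; rewrite big1 // => d2 _; rewrite big1 // => d3 _.
  by case: and3P => [[/eqP-> /eqP-> /eqP->]|]; rewrite ?T0 ?mulr0 ?mul0r.
rewrite (bigD1 (inord a)) //= [X in _ + X]big1 ?addr0; last first.
  move=> d1 /eqP d1a; rewrite big1 // => d2 _; rewrite big1 // => d3 _.
  have [d1E|_] := eqVneq (d1 : nat) a; last by rewrite mulr0.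
  by case: d1a; apply: val_inj; rewrite /= inordK.
rewrite (bigD1 (inord b)) //= [X in _ + X]big1 ?addr0; last first.
  move=> d1 /eqP d1a; rewrite big1 // => d3 _.
  have [d1E|_] := eqVneq (d1 : nat) b; last by rewrite andbF mulr0.
  by case: d1a; apply: val_inj; rewrite /= inordK.
rewrite (bigD1 (inord c)) //= [X in _ + X]big1 ?addr0; last first.
  move=> d1 /eqP d1a.
  have [d1E|_] := eqVneq (d1 : nat) c; last by rewrite !andbF mulr0.
  by case: d1a; apply: val_inj; rewrite /= inordK.
by rewrite !inordK ?ltnS // !eqxx mulr1.
Qed.

Lemma sqrt_1_sub_4t (R : comUnitRingType) : (2%:R : R) \is a GRing.unit ->
  exists! y : {fps R}, y ^+ 2 = 1 - 4%:R * fpsX R /\ y 0%N = 1.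
Proof.
move=> U2; set t := fpsX R.
pose s k : {fps R} := iter k (fun c => 1 + t * c ^+ 2) 0.
have sS k : s k.+1 = 1 + t * s k ^+ 2 by [].
have coef_sqr (f g : {fps R}) n :
    (forall i, (i <= n)%N -> f i = g i) -> (f ^+ 2) n = (g ^+ 2) n.
  move=> fg; rewrite !expr2 !fps_coefM; apply: eq_bigr => i _.
  by rewrite !fg ?leq_subr // -ltnS.
have s_stable n k : (n < k)%N -> s k.+1 n = s k n.
  elim: k n => // k IHk n; rewrite ltnS => le_nk.
  rewrite (sS k.+1) (sS k) !fps_coefD !fps_coefXM; case: n le_nk => // n lt_nk.
  by congr (_ + _); apply: coef_sqr => i le_in; apply/IHk/leq_trans/lt_nk.
have s_lim n k : (n < k)%N -> s k n = s n.+1 n.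
  elim: k => // k IHk; rewrite ltnS leq_eqVlt => /predU1P[-> //|lt_nk].
  by rewrite s_stable ?IHk.
pose c : {fps R} := \fps_n s n.+1 n.
have cE : c = 1 + t * c ^+ 2.
  apply/fpsP => n; transitivity (s n.+1 n) => //; rewrite sS !fps_coefD !fps_coefXM; case: n => // n; congr (_ + _).
  by apply: coef_sqr => i le_in; rewrite s_lim.
pose y := 1 - 2%:R * (t * c).
have y0 : y 0%N = 1 by rewrite fps_coefB mulrCA fps_coefXM subr0 fps_coef1.
have yE : y ^+ 2 = 1 - 4%:R * t.
  have -> : y ^+ 2 = 1 - 4%:R * t * (c - t * c ^+ 2) by rewrite /y; ring.
  by rewrite {1}cE addrK mulr1.
exists y; split=> // z [zE z0].
have /eqP : (y + z) * (y - z) = 0 by rewrite mulrC -subr_sqr yE zE subrr.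
have U : y + z \is a GRing.unit by rewrite fps_unitE fps_coefD y0 z0.
by move=> /eqP/(canRL (mulKr U)); rewrite mulr0 => /subr0_eq.
Qed.

(* Main.v *)
Require Import Defs.
From HB Require Import structures.
From mathcomp Require Import all_boot all_order all_algebra all_fingroup.
From mathcomp Require Import boolp.
From mathcomp Require Import mpoly ring.
From mathcomp Require Import zify.

Set Implicit Arguments.
Unset Strict Implicit.
Unset Printing Implicit Defensive.

Import GRing.Theory.

(** A closed formula for the number of trees comes first. Fix the vertex
    permutation sigma on the 2e half-edges, with e + 1 cycles. Connectedness
    only sees which half-edges lie on which vertex, so the number of matchings
    alpha that make sigma a plane tree depends only on the degrees: it is
    (e - 1)! times the product of the degrees, the weighted form of Cayley's
    formula. It follows by induction on e, removing a leaf
    ([card_spanning_trees]).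

    Summing over sigma, the product of the degrees of the vertices without
    root is the number of ways to root them too, up to the order in which
    this is done ([card_completions]). A permutation with a root in every
    cycle and prescribed cycle lengths is the same as a numbering of the
    half-edges, so there are (2e)! of these ([card_rooted_cycles]), and the
    degrees that are not prescribed range over compositions. Rooted trees
    have no automorphism, so every isomorphism class contains (2e)! labelled
    trees ([card_three_rooted_trees]). Altogether, with j = d1 + d2 + d3 - 3,
    the number of three-rooted trees is
      (e - 1) d1 d2 d3 binomial(2e - j - 4, e - 1 - j)
    ([num_three_rooted_treesE]).

    For the generating function, let u = (1 - y) / 2, so that t = u (1 - u)
    and y = 1 - 2u. With m = e - 1, the sum of binomial(2m - j - 2, m - j) t^m
    over m is u^j (1 - u)^2 / y: Pascal's rule becomes the recurrence
    u^(j+1) = u^(j+2) + t u^j, and the initial values come from the central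
    binomial series 1 / y ([excess_series_closed]). Summing over the degrees
    gives
      M = x1 x2 x3 (1 - u)^2 / (y P^2),  P = product of the (1 - x_i u),
    and the factor m is a derivation in t: the generating function is
    t^2 times the derivative of M. As y u' = 1, this is a rational function
    of u ([roots_series_rational]). *)

(** * Counting trees on a given set of vertices *)

Section Matchings.

Variables (H V : finType) (p : H -> V).
Implicit Types (A : {set H}) (B : {set V}) (alpha : {perm H}).

(** As a permutation of the whole type that moves exactly the elements of A,
    so that removing an edge changes A but not the type. *)
Definition matching_on A alpha :=
  [forall h, (alpha (alpha h) == h) && ((alpha h == h) == (h \notin A))].

Definition edge_closed alpha (C : {set V}) :=
  [forall h, (p h \in C) ==> (p (alpha h) \in C)].

(** Connectedness of the graph with vertex set B: no proper nonempty set of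
    vertices is closed under following edges. *)
Definition edge_connected B alpha :=
  [forall C : {set V},
    [&& C \subset B, C != set0 & edge_closed alpha C] ==> (C == B)].

Definition incident A v := [set h in A | p h == v].

Definition spanning_trees A B :=
  [set alpha | matching_on A alpha && edge_connected B alpha].

Lemma matching_onP A alpha :
  reflect (involutive alpha /\ forall h, (alpha h == h) = (h \notin A))
          (matching_on A alpha).
Proof.
apply: (iffP forallP) => [mA|[aK aA] h]; last by rewrite aK aA !eqxx.
by split=> h; have /andP[/eqP ? /eqP ?] := mA h.
Qed.

Lemma edge_closedP alpha (C : {set V}) :
  reflect (forall h, p h \in C -> p (alpha h) \in C) (edge_closed alpha C).
Proof. by apply: (iffP forallP) => cC h; apply/implyP/(cC h). Qed.

Lemma edge_connectedP B alpha :
  reflect (forall C : {set V}, C \subset B -> C != set0 ->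
             (forall h, p h \in C -> p (alpha h) \in C) -> C = B)
          (edge_connected B alpha).
Proof.
apply: (iffP forallP) => [cB C sCB C0 /edge_closedP cC|cB C].
  by apply/eqP; have /implyP := cB C; apply; rewrite sCB C0.
by apply/implyP => /and3P[sCB C0 /edge_closedP cC]; apply/eqP/cB.
Qed.

Lemma matching_on_in A alpha h : matching_on A alpha -> h \in A -> alpha h \in A.
Proof.
case/matching_onP=> aK aA hA; apply: contraLR hA; rewrite -!aA aK.
by move=> /eqP <-.
Qed.

Section Leaf.

Variables (A : {set H}) (B : {set V}) (h : H).
Hypotheses (hA : h \in A) (pA : forall k, k \in A -> p k \in B).
Hypothesis leaf : incident A (p h) = [set h].

Let leafP k : k \in A -> p k = p h -> k = h.
Proof.
move=> kA pk; have : k \in incident A (p h) by rewrite inE kA pk eqxx.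
by rewrite leaf => /set1P.
Qed.

(** The matchings that pair h with h' correspond to the matchings of the
    remaining half-edges, by composing with the transposition of h and h'. *)
Lemma matching_on_tperm h' alpha : h' \in A -> h' != h ->
  (matching_on A (alpha * tperm h h') && ((alpha * tperm h h')%g h == h')) =
  matching_on (A :\ h :\ h') alpha.
Proof.
move=> h'A h'h; apply/andP/idP => [[/matching_onP[bK bA] /eqP bh]|].
  set b := (alpha * _)%g in bK bA bh.
  have aE k : alpha k = tperm h h' (b k) by rewrite permM tpermK.
  have bh' : b h' = h by rewrite -bh bK.
  have ah : alpha h = h by rewrite aE bh tpermR.
  have ah' : alpha h' = h' by rewrite aE bh' tpermL.
  have aN k : k != h -> k != h' -> alpha k = b k.
    move=> kh kh'; rewrite aE tpermD // eq_sym.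
      by apply: contra kh' => /eqP bk; rewrite -(bK k) bk bh.
    by apply: contra kh => /eqP bk; rewrite -(bK k) bk bh'.
  apply/matching_onP; split=> k.
    have [->|kh] := eqVneq k h; first by rewrite !ah.
    have [->|kh'] := eqVneq k h'; first by rewrite !ah'.
    rewrite (aN k) // aN ?bK //.
      by apply: contra kh' => /eqP bk; rewrite -(bK k) bk bh.
      by apply: contra kh => /eqP bk; rewrite -(bK k) bk bh'.
  rewrite !inE; have [->|kh] := eqVneq k h; first by rewrite ah eqxx andbF.
  have [->|kh'] := eqVneq k h'; first by rewrite ah' eqxx.
  by rewrite aN // bA.
case/matching_onP => aK aA.
have ah : alpha h = h by apply/eqP; rewrite aA !inE eqxx andbF.
have ah' : alpha h' = h' by apply/eqP; rewrite aA !inE eqxx.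
have bh : (alpha * tperm h h')%g h = h' by rewrite permM ah tpermL.
have bh' : (alpha * tperm h h')%g h' = h by rewrite permM ah' tpermR.
have bN k : k != h -> k != h' -> (alpha * tperm h h')%g k = alpha k.
  move=> kh kh'; rewrite permM tpermD // eq_sym.
    by apply: contra kh => /eqP ak; rewrite -(aK k) ak ah.
  by apply: contra kh' => /eqP ak; rewrite -(aK k) ak ah'.
split; last by rewrite bh.
apply/matching_onP; split=> k.
  have [->|kh] := eqVneq k h; first by rewrite bh.
  have [->|kh'] := eqVneq k h'; first by rewrite bh'.
  rewrite (bN k) // bN ?aK //.
    by apply: contra kh => /eqP ak; rewrite -(aK k) ak ah.
  by apply: contra kh' => /eqP ak; rewrite -(aK k) ak ah'.
have [->|kh] := eqVneq k h; first by rewrite bh (negPf h'h) hA.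
have [->|kh'] := eqVneq k h'; first by rewrite bh' eq_sym (negPf h'h) h'A.
by rewrite bN // aA !inE kh kh'.
Qed.

(** A closed set of vertices of the smaller graph extends by the leaf p h if
    it contains its neighbour p h'; conversely a closed set of the larger graph
    cannot be reduced to the leaf, so it restricts to a nonempty one. *)
Lemma edge_connected_tperm h' alpha : h' \in A -> h' != h ->
  matching_on (A :\ h :\ h') alpha ->
  edge_connected B (alpha * tperm h h') = edge_connected (B :\ p h) alpha.
Proof.
move=> h'A h'h mA; have := mA; rewrite -matching_on_tperm //.
case/andP=> mA' /eqP bh; set b := (alpha * _)%g in mA' bh *.
case/matching_onP: mA => aK aA; case/matching_onP: (mA') => bK bA.
have bh' : b h' = h by rewrite -bh bK.
have ph' : p h' != p h by apply: contra h'h => /eqP /leafP ->.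
have bN k : k != h -> k != h' -> b k = alpha k.
  move=> kh kh'; rewrite /b permM tpermD // eq_sym.
    by apply: contra kh => /eqP ak; rewrite -(aK k) ak aA !inE eqxx andbF.
  by apply: contra kh' => /eqP ak; rewrite -(aK k) ak aA !inE eqxx.
have ah : alpha h = h by apply/eqP; rewrite aA !inE eqxx andbF.
have ah' : alpha h' = h' by apply/eqP; rewrite aA !inE eqxx.
have phB : p h \in B by apply: pA.
apply/edge_connectedP/edge_connectedP => cB C sCB /set0Pn[v0 v0C] cC.
  have phC : p h \notin C.
    by apply/negP => /(subsetP sCB); rewrite !inE eqxx.
  have sCB' : C \subset B by apply: subset_trans sCB (subsetDl _ _).
  have [ph'C|ph'C] := boolP (p h' \in C).
    rewrite -(cB (p h |: C)) ?setU1K // ?subUset ?sub1set ?phB //.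
      by apply/set0Pn; exists (p h); rewrite setU11.
    move=> k; have [->|kh] := eqVneq k h; first by rewrite bh !inE ph'C orbT.
    have [->|kh'] := eqVneq k h'; first by rewrite bh' setU11.
    rewrite bN // !inE => /orP[/eqP pk|/cC ->]; last by rewrite orbT.
    have [kA|kA] := boolP (k \in A); first by rewrite (leafP kA pk) eqxx in kh.
    suff -> : alpha k = k by rewrite pk eqxx.
    by apply/eqP; rewrite aA !inE (negPf kA) !andbF.
  case/negP: phC; rewrite (cB C) //; first by apply/set0Pn; exists v0.
  move=> k; have [->|kh] := eqVneq k h.
    by move=> /(subsetP sCB); rewrite !inE eqxx.
  have [->|kh'] := eqVneq k h'; first by rewrite (negPf ph'C).
  by rewrite bN //; apply: cC.
have cC' : C :\ p h = B :\ p h.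
  apply: cB; first exact: setSD.
    apply/set0Pn; have [v0h|] := eqVneq v0 (p h); last first.
      by move=> ?; exists v0; rewrite !inE; apply/andP.
    exists (p h'); rewrite !inE ph' -bh; apply: cC; by rewrite -v0h.
  move=> k; rewrite !inE => /andP[pk kC].
  have kh : k != h by apply: contra pk => /eqP ->.
  have [kE|kh'] := eqVneq k h'; first by rewrite kE ah' ph' -kE kC.
  rewrite -bN // cC // andbT; apply/negP => /eqP pbk.
  have [kA|kA] := boolP (k \in A).
    have bkh : b k = h by apply: leafP pbk; apply: matching_on_in mA' kA.
    by case/eqP: kh'; rewrite -(bK k) bkh bh.
  have bk : b k = k by apply/eqP; rewrite bA.
  by rewrite -pbk bk eqxx in pk.
have : p h' \in C :\ p h by rewrite cC' !inE ph' pA.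
rewrite !inE ph' /= => /cC; rewrite bh' => phC.
by rewrite -(setD1K phC) cC' setD1K.
Qed.

(** Removal of the leaf p h, according to the half-edge h' glued to h. *)
Lemma card_spanning_trees_leaf :
  #|spanning_trees A B| =
  \sum_(h' in A :\ h) #|spanning_trees (A :\ h :\ h') (B :\ p h)|.
Proof.
rewrite -sum1_card (partition_big (fun alpha : {perm H} => alpha h)
  (fun h' => h' \in A :\ h)) => [|alpha]; last first.
  rewrite !inE => /andP[mA _]; have /matching_onP[_ ->] := mA.
  by rewrite hA (matching_on_in mA).
apply: eq_bigr => h'; rewrite !inE => /andP[h'h h'A].
rewrite sum1dep_card.
rewrite -[RHS](card_imset _ (mulIg (tperm h h'))) /=; apply: eq_card => alpha.
apply/idP/imsetP => [|[b]]; rewrite ?inE.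
  case/andP=> /andP[mA cA] ah; exists (alpha * tperm h h')%g; last first.
    by rewrite -mulgA tperm2 mulg1.
  have mA' : matching_on (A :\ h :\ h') (alpha * tperm h h').
    by rewrite -matching_on_tperm // -mulgA tperm2 mulg1 mA.
  by rewrite !inE mA' -(edge_connected_tperm h'A) // -mulgA tperm2 mulg1.
case/andP=> mA cA ->.
by rewrite edge_connected_tperm // cA andbT matching_on_tperm.
Qed.

End Leaf.

Lemma sum_card_incident A B : (forall k, k \in A -> p k \in B) ->
  \sum_(v in B) #|incident A v| = #|A|.
Proof.
move=> pA; rewrite -sum1_card (partition_big p (fun v => v \in B)) //.
apply: eq_bigr => v _; rewrite sum1dep_card.
by apply: eq_card => k; rewrite !inE.
Qed.

(** An isolated vertex is closed under following edges. *)
Lemma spanning_trees_isolated A B v : v \in B -> 1 < #|B| ->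
  incident A v = set0 -> spanning_trees A B = set0.
Proof.
move=> vB B1 iv; apply/setP => alpha; rewrite !inE; apply/negP.
case/andP => /matching_onP[_ aA] /edge_connectedP/(_ [set v]) cB.
move: B1; rewrite -cB ?sub1set ?cards1 //.
  by apply/set0Pn; exists v; rewrite set11.
move=> k /set1P pk; suff /eqP -> : alpha k == k by rewrite pk set11.
rewrite aA; apply/negP => kA.
have : k \in incident A v by rewrite inE kA pk eqxx.
by rewrite iv inE.
Qed.

Lemma card_spanning_trees0 w : #|spanning_trees set0 [set w]| = 1.
Proof.
apply/eqP/cards1P; exists 1%g; apply/setP => alpha; rewrite !inE.
apply/andP/eqP => [[/matching_onP[_ aA] _]|->].
  by apply/permP => k; rewrite perm1; apply/eqP; rewrite aA inE.
split; first by apply/matching_onP; split=> k; rewrite !perm1 // eqxx inE.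
apply/edge_connectedP => C; rewrite subset1 => /orP[/eqP -> //|/eqP ->].
by rewrite eqxx.
Qed.

(** With 2n + 2 half-edges on n + 2 vertices, either some vertex is isolated
    and both sides vanish, or some vertex is a leaf. After the removal of a leaf
    and of its edge to a vertex u, the product of the degrees d becomes
    (d_u - 1) / d_u times what it was, and there are d_u edges to choose from;
    the sum of the d_u - 1 over the other vertices is n. *)
Lemma card_spanning_trees n A B : (forall k, k \in A -> p k \in B) ->
  #|B| = n.+2 -> #|A| = n.+1.*2 ->
  #|spanning_trees A B| = n`! * \prod_(v in B) #|incident A v|.
Proof.
elim: n A B => [|n IHn] A B pA cardB cardA.
all: have B1 : 1 < #|B| by rewrite cardB.
all: have sumA := sum_card_incident pA.
(* An isolated vertex makes both sides vanish. *)
all: have [/existsP[v /andP[vB /eqP iv0]]|/existsPn d0] :=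
  boolP [exists v, (v \in B) && (incident A v == set0)];
  first by rewrite (spanning_trees_isolated vB B1 iv0) (bigD1 v) //= iv0
                   !cards0 mul0n muln0.
all: have {}d0 v : v \in B -> 0 < #|incident A v|
  by move=> vB; rewrite card_gt0; move: (d0 v); rewrite vB.
(* If all degrees were at least 2, they would sum to at least 2 (n + 2). *)
all: have [/existsP[v /andP[vB /cards1P[h iv]]]|/existsPn d1] :=
  boolP [exists v, (v \in B) && (#|incident A v| == 1)];
  last by (have : \sum_(v in B) 2 <= \sum_(v in B) #|incident A v|
             by apply: leq_sum => v vB; move: (d1 v) (d0 v vB);
                rewrite vB /=; lia);
          rewrite sumA sum_nat_const cardB cardA; lia.
all: have /[!inE]/andP[hA /eqP vE] : h \in incident A v by rewrite iv set11.
all: subst v; have cardB' : #|B :\ p h| = #|B|.-1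
  by rewrite (cardsD1 (p h) B) vB.
all: have cardA' : #|A :\ h| = #|A|.-1 by rewrite (cardsD1 h A) hA.
all: have pA' h' : h' \in A :\ h -> p h' \in B :\ p h
  by rewrite !inE => /andP[h'h h'A]; rewrite pA // andbT;
     apply: contra h'h => /eqP ph'; rewrite -in_set1 -iv inE h'A ph' eqxx.
all: rewrite (card_spanning_trees_leaf hA pA iv).
  have /eqP/cards1P[w Bw] : #|B :\ p h| = 1 by rewrite cardB' cardB.
  have /eqP/cards1P[h' Ah'] : #|A :\ h| = 1 by rewrite cardA' cardA.
  rewrite Ah' big_set1 Bw setDv card_spanning_trees0 fact0 mul1n.
  rewrite (bigD1 (p h)) //= iv cards1 mul1n; apply/esym/eqP.
  rewrite (bigD1 (p h)) //= iv cards1 cardA in sumA.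
  rewrite (eq_bigl (mem [set w])) ?big_set1 => [|k]; last first.
    by rewrite -Bw !inE andbC.
  rewrite (eq_bigl (mem [set w])) ?big_set1 in sumA => [|k]; last first.
    by rewrite -Bw !inE andbC.
  by move: sumA; lia.
set P := \prod_(v in B :\ p h) #|incident A v|.
have PE : \prod_(v in B) #|incident A v| = P.
  rewrite (bigD1 (p h)) //= iv cards1 mul1n.
  by apply: eq_bigl => v; rewrite !inE andbC.
pose Q u := \prod_(v in B :\ p h | v != u) #|incident A v|.
have QE u : u \in B :\ p h -> #|incident A u| * Q u = P.
  by move=> uB; rewrite /P (bigD1 u).
rewrite PE.
(* The removal of h' lowers the degree of its vertex by one. *)
transitivity (\sum_(h' in A :\ h) n`! * (#|incident A (p h')|.-1 * Q (p h'))).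
  apply: eq_bigr => h' h'A; rewrite (IHn _ (B :\ p h)); last 1 first.
  - by have := cardsD1 h' (A :\ h); rewrite h'A cardA' cardA /=; lia.
  - congr (_ * _); rewrite (bigD1 (p h')) ?pA' //=; congr (_ * _).
      have : h' \in incident A (p h') by move: h'A; rewrite !inE eqxx => /andP[_ ->].
      move=> h'i; rewrite (cardsD1 h' (incident A _)) h'i /=; apply: eq_card => k.
      rewrite !inE; case: (eqVneq (p k) _) => [pk|]; rewrite ?andbF //.
      rewrite !andbT; case: (eqVneq k h) => // kh; exfalso.
      by have := pA' _ h'A; rewrite -pk kh !inE eqxx.
    apply: eq_bigr => u /andP[]; rewrite !inE => /andP[uh uB] uh'.
    apply: eq_card => k; rewrite !inE.
    case: (eqVneq (p k) _) => [pk|]; rewrite ?andbF // !andbT.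
    have [kE|_] := eqVneq k h'; first by rewrite -pk kE eqxx in uh'.
    by have [kE|//] := eqVneq k h; first by rewrite -pk kE eqxx in uh.
  - by move=> k; rewrite 2!inE => /andP[_ kA]; apply: pA'.
  - by rewrite cardB' cardB.
rewrite (partition_big p (fun u => u \in B :\ p h)) //=.
transitivity (\sum_(u in B :\ p h) n`! * (#|incident A u|.-1 * P)).
  apply: eq_bigr => u uB.
  transitivity (\sum_(h' in incident A u) n`! * (#|incident A u|.-1 * Q u)).
    apply: eq_big => [k|k /andP[_ /eqP -> //]].
    rewrite !inE; case: (eqVneq (p k) _) => [pk|]; rewrite ?andbF // !andbT.
    case: eqP => // kE; move: uB; by rewrite -pk kE !inE eqxx.
  by rewrite sum_nat_const -(QE u uB); lia.
rewrite -big_distrr -big_distrl /= mulnCA mulnA factS; congr (_ * _ * _).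
have : \sum_(u in B :\ p h) #|incident A u|.-1 + #|B :\ p h| + 1 = #|A|.
  rewrite -sumA [RHS](bigD1 (p h)) //= iv cards1 addnC; congr (_ + _).
  rewrite -sum1_card -big_split /=; apply: eq_big => [u|u].
    by rewrite !inE andbC.
  by rewrite !inE => /andP[_ uB]; have := d0 u uB; lia.
rewrite cardB' cardB cardA; lia.
Qed.

End Matchings.

(** * Plane trees with a prescribed vertex permutation *)

Section TreesOnVertices.

Variable H : finType.
Implicit Types alpha sigma : {perm H}.

Lemma orbit_group_closed alpha sigma x0 (h : H) a :
  a \in <<[set alpha; sigma]>>%g ->
  h \in orbit 'P <<[set alpha; sigma]>>%g x0 ->
  a h \in orbit 'P <<[set alpha; sigma]>>%g x0.
Proof. by move=> aG /orbitP[b bG <-]; rewrite -permM; apply/mem_orbit/groupM. Qed.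

Lemma transitive_closed alpha sigma (S : {set H}) x :
  [transitive <<[set alpha; sigma]>>%g, on [set: H] | 'P] -> x \in S ->
  (forall h, h \in S -> alpha h \in S) -> (forall h, h \in S -> sigma h \in S) ->
  S = setT.
Proof.
move=> trG xS alphaS sigmaS; apply/eqP; rewrite -subTset.
rewrite -(atransP trG x) // acts_sub_orbit //.
rewrite gen_subG; apply/subsetP => a; rewrite !inE /= => /orP[]/eqP ->;
  by apply/subsetP => k kS; rewrite inE /= apermE ?alphaS ?sigmaS.
Qed.

(** Sets of half-edges invariant under both permutations are the same as sets
    of vertices closed under following edges. *)
Lemma transitive_edge_connected alpha sigma : 0 < #|H| ->
  [transitive <<[set alpha; sigma]>>%g, on [set: H] | 'P] =
  edge_connected (porbit sigma) (porbits sigma) alpha.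
Proof.
move=> H0; set G := <<_>>%g.
have aG : alpha \in G by rewrite mem_gen ?inE ?eqxx.
have sG : sigma \in G by rewrite mem_gen ?inE ?eqxx ?orbT.
have porbitE k : porbit sigma (sigma k) = porbit sigma k.
  by apply/eqP; rewrite eq_porbit_mem; have := mem_porbit sigma 1 k; rewrite expg1.
apply/idP/edge_connectedP => [trG C sC /set0Pn[c cC] closC|cB].
  (* The half-edges on the vertices of a closed set C are stable. *)
  pose S := [set h | porbit sigma h \in C].
  have /imsetP[x _ cE] := subsetP sC c cC.
  apply/eqP; rewrite eqEsubset sC /=; apply/subsetP => _ /imsetP[h _ ->].
  have xS : x \in S by rewrite inE -cE.
  have : h \in S; last by rewrite inE.
  rewrite (transitive_closed trG xS) // => k; rewrite !inE; first exact: closC.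
  by rewrite porbitE.
have /card_gt0P[x0 _] := H0.
apply/imsetP; exists x0; first by [].
apply/eqP; rewrite eq_sym -subTset; apply/subsetP => h _.
(* Conversely, the vertices met by an orbit form a closed set. *)
pose C := porbit sigma @: orbit 'P G x0.
have CE : C = porbits sigma.
  apply: cB; first by apply/subsetP => _ /imsetP[k _ ->]; apply: imset_f.
    by apply/set0Pn; exists (porbit sigma x0); rewrite imset_f ?orbit_refl.
  move=> k /imsetP[k' k'o /eqP]; rewrite eq_porbit_mem => /porbitP[i ->].
  by rewrite imset_f //; do 2!apply: orbit_group_closed => //; apply: groupX.
have : porbit sigma h \in C by rewrite CE imset_f.
case/imsetP => k ko /eqP; rewrite eq_porbit_mem => /porbitP[i ->].
by apply: orbit_group_closed ko; apply: groupX.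
Qed.

Lemma plane_tree_spanning e alpha sigma :
  plane_tree e alpha sigma =
  [&& 0 < e, #|H| == e.*2, #|porbits sigma| == e.+1
    & alpha \in spanning_trees (porbit sigma) setT (porbits sigma)].
Proof.
rewrite /plane_tree; case: (posnP e) => //= e0.
case: eqP => //= cardH; rewrite inE.
rewrite transitive_edge_connected ?cardH ?double_gt0 //.
have -> : matching_on setT alpha =
    [forall h, alpha (alpha h) == h] && [forall h, alpha h != h].
  apply/matching_onP/andP => [[aK aN]|[/forallP aK /forallP aN]].
    by split; apply/forallP => h; rewrite ?aK // aN inE.
  by split=> h; [apply/eqP | rewrite inE (negPf (aN h))].
by do ![case: [forall h, _]]; rewrite ?andbF //= andbC.
Qed.

Lemma incident_porbit sigma c : c \in porbits sigma ->
  incident (porbit sigma) setT c = c.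
Proof.
by case/imsetP=> x _ ->; apply/setP => k; rewrite !inE /= eq_porbit_mem.
Qed.

(** The number depends on sigma only through its cycle type. *)
Lemma card_plane_trees e sigma : 0 < e -> #|H| = e.*2 ->
  #|porbits sigma| = e.+1 ->
  #|[set alpha | plane_tree e alpha sigma]| =
  e.-1`! * \prod_(c in porbits sigma) #|c|.
Proof.
move=> e0 cardH cards.
have -> : [set alpha | plane_tree e alpha sigma] =
    spanning_trees (porbit sigma) setT (porbits sigma).
  by apply/setP => a; rewrite inE plane_tree_spanning e0 cardH cards !eqxx.
rewrite (@card_spanning_trees _ _ _ e.-1) ?cardsT ?prednK //; last first.
  by move=> k _; apply: imset_f.
by congr (_ * _); apply: eq_bigr => c /incident_porbit ->.
Qed.

Lemma sum_card_porbits sigma : \sum_(c in porbits sigma) #|c| = #|H|.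
Proof.
rewrite -cardsT -(@sum_card_incident _ _ (porbit sigma) _ (porbits sigma)).
  by apply: eq_bigr => c /incident_porbit ->.
by move=> k _; apply: imset_f.
Qed.

End TreesOnVertices.

(** * Permutations with a root in every cycle *)

Section RootedCycles.

Variables (I H : finType) (d : I -> nat).
Implicit Types (sigma : {perm H}) (rho : {ffun I -> H}).

Definition distinct_cycles sigma rho := injectiveb (fun i => porbit sigma (rho i)).

(** Nothing forces the marked cycles to cover H: this holds in
    [card_rooted_cycles], where the lengths d sum to #|H|. *)
Definition rooted_cycles := [set sr : {perm H} * {ffun I -> H} |
  distinct_cycles sr.1 sr.2 & [forall i, #|porbit sr.1 (sr.2 i)| == d i]].

(** The standard model: a disjoint union of cycles [next] of lengths d i,
    each rooted at 0. A permutation with rooted cycles of these lengths is the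
    same as a bijection [chart] of the model with H. *)
Let D := {i : I & 'I_(d i)}.

Let next (x : D) : D := Tagged (fun i => 'I_(d i)) (ordS (tagged x)).

Let chart (sr : {perm H} * {ffun I -> H}) : {ffun D -> H} :=
  [ffun x : D => (sr.1 ^+ tagged x)%g (sr.2 (tag x))].

Let chart_inj sr : sr \in rooted_cycles -> injective (chart sr).
Proof.
rewrite inE => /andP[/injectiveP rI /forallP rd] [i k] [j l].
rewrite !ffunE /= => eq_kl; have ij : i = j.
  apply: rI; apply/eqP; rewrite eq_porbit_mem -(porbit_perm _ l).
  by rewrite -eq_kl porbit_perm porbit_id.
subst j; congr (Tagged _ _); apply/val_inj/eqP => /=.
have szT := size_traject sr.1 (sr.2 i) #|porbit sr.1 (sr.2 i)|.
rewrite -(nth_uniq (sr.2 i) _ _ (uniq_traject_porbit sr.1 (sr.2 i))) ?szT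
  ?(eqP (rd i)) ?ltn_ord //.
by rewrite !nth_traject ?(eqP (rd i)) ?ltn_ord // -!permX eq_kl.
Qed.

Let chart_next sr x : sr \in rooted_cycles -> sr.1 (chart sr x) = chart sr (next x).
Proof.
rewrite inE => /andP[_ /forallP rd]; case: x => i k; rewrite !ffunE /=.
rewrite -permM -expgSr; have := ltn_ord k; rewrite leq_eqVlt => /orP[/eqP kd|kd].
  by rewrite kd modnn expg0 perm1 -(eqP (rd i)) permX iter_porbit.
by rewrite modn_small.
Qed.

Hypotheses (d_gt0 : forall i, 0 < d i) (sum_d : \sum_i d i = #|H|).

Let cardD : #|{: D}| = #|H|.
Proof.
rewrite card_tagged sumnE big_map -sum_d big_enum.
by apply: eq_bigr => i _; rewrite card_ord.
Qed.

Let iter_ordS n i (k : 'I_(d i)) : iter n (@ordS _) k = (k + n) %% d i :> nat.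
Proof.
elim: n => [|n IHn] /=; first by rewrite addn0 modn_small.
by rewrite IHn -addn1 modnDml -addnA addn1.
Qed.

Let chart_surj (theta : {ffun D -> H}) : injective theta ->
  exists2 sr, sr \in rooted_cycles & chart sr = theta.
Proof.
move=> thI; have [|g gK Kg] := inj_card_bij thI; first by rewrite cardD.
have nextI : injective next.
  case=> i k [j l] eq_kl; have ij : i = j by have /(congr1 tag) := eq_kl.
  subst j; congr (Tagged _ _); apply: ordS_inj.
  by have /eqP := eq_kl; rewrite eq_Tagged => /eqP.
have sI : injective (fun h => theta (next (g h))).
  by move=> h h' /thI /nextI /(can_inj Kg).
pose sigma := perm sI; pose rho := [ffun i => theta (Tagged _ (Ordinal (d_gt0 i)))].
have sE n i (k : 'I_(d i)) : (sigma ^+ n)%g (theta (Tagged _ k)) =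
    theta (Tagged _ (iter n (@ordS _) k)).
  elim: n => [|n IHn]; first by rewrite expg0 perm1.
  by rewrite expgSr permM IHn permE gK.
have iter0 i (k : 'I_(d i)) : iter k (@ordS _) (Ordinal (d_gt0 i)) = k.
  by apply: val_inj; rewrite /= iter_ordS /= add0n modn_small.
have thE i (k : 'I_(d i)) : (sigma ^+ k)%g (rho i) = theta (Tagged _ k).
  by rewrite ffunE sE iter0.
have orbE i : porbit sigma (rho i) = [set theta (Tagged _ k) | k : 'I_(d i)].
  apply/setP => h; apply/porbitP/imsetP => [[n ->]|[k _ ->]].
    by eexists; last by rewrite ffunE sE.
  by exists k.
exists (sigma, rho); last first.
  by apply/ffunP => -[i k]; rewrite ffunE /= thE.
rewrite inE; apply/andP; split.
  apply/injectiveP => i j /= /eqP; rewrite eq_porbit_mem orbE => /imsetP[k _].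
  by rewrite ffunE => /thI /(congr1 tag).
apply/forallP => i /=; rewrite orbE card_imset ?card_ord //.
by move=> k l /thI /eqP; rewrite eq_Tagged => /eqP.
Qed.

(** The charts are exactly the injections of the model into H. *)
Lemma card_rooted_cycles : #|rooted_cycles| = #|H|`!.
Proof.
rewrite -ffactnn -[X in _ ^_ X]cardD -card_inj_ffuns -(card_in_imset (f := chart)).
  apply: eq_card => theta; rewrite inE; apply/imsetP/injectiveP => [[sr srR ->]|].
    exact: chart_inj.
  by case/chart_surj=> sr srR <-; exists sr.
move=> sr sr' srR sr'R eq_chart.
have rhoE i : sr.2 i = sr'.2 i.
  have /ffunP/(_ (Tagged _ (Ordinal (d_gt0 i)))) := eq_chart.
  by rewrite !ffunE /= !expg0 !perm1.
have sigmaE h : sr.1 h = sr'.1 h.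
  have [|g _ Kg] := inj_card_bij (chart_inj srR); first by rewrite cardD.
  by rewrite -(Kg h) chart_next // eq_chart chart_next.
case: sr sr' rhoE sigmaE {srR sr'R eq_chart} => s r [s' r'] /= rE sE.
by congr (_, _); [apply/permP|apply/ffunP].
Qed.

End RootedCycles.

(** * Completing a partial choice of roots *)

Section RootCompletion.

Variables (J H : finType) (k : nat).
Implicit Types (sigma : {perm H}) (r : {ffun J -> H}).
Implicit Types (rho : {ffun J + 'I_k -> H}) (delta : J -> nat).

Definition prefix_roots rho : {ffun J -> H} := [ffun j => rho (inl j)].

Lemma distinct_cycles_prefix sigma rho :
  distinct_cycles sigma rho -> distinct_cycles sigma (prefix_roots rho).
Proof.
move=> /injectiveP rI; apply/injectiveP => i j.
by rewrite !ffunE => /(rI (inl i) (inl j)) [].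
Qed.

(** The order in which the k remaining cycles are rooted gives k!, and the
    choice of the root in each gives its length; the lengths of the cycles that
    were rooted from the start are multiplied in on both sides. *)
Lemma card_completions sigma r : distinct_cycles sigma r ->
  #|porbits sigma| = #|J| + k ->
  #|[set rho | distinct_cycles sigma rho & prefix_roots rho == r]| *
    \prod_j #|porbit sigma (r j)| = k`! * \prod_(c in porbits sigma) #|c|.
Proof.
move=> /injectiveP rI cards.
pose R := [set porbit sigma (r j) | j : J].
pose O := porbits sigma :\: R.
have sR : R \subset porbits sigma.
  by apply/subsetP => _ /imsetP[j _ ->]; apply: imset_f.
have cardO : #|O| = k.
  by rewrite cardsD (setIidPr sR) cards card_imset // addKn.
have -> : \prod_(c in porbits sigma) #|c| =
    (\prod_(c in O) #|c|) * \prod_j #|porbit sigma (r j)|.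
  rewrite (big_setID R) /= (setIidPr sR) mulnC; congr (_ * _).
  by rewrite big_imset //= => i j _ _; apply: rI.
rewrite mulnA; congr (_ * _).
pose beta rho := [ffun i : 'I_k => porbit sigma (rho (inr i))].
pose B := [set f : {ffun 'I_k -> {set H}} in ffun_on (mem O) | injectiveb f].
have cardB : #|B| = k`! by rewrite card_inj_ffuns_on cardO card_ord ffactnn.
rewrite -sum1_card (partition_big beta (fun f => f \in B)) => [|rho]; last first.
  rewrite inE => /andP[/injectiveP rhoI /eqP rhor]; rewrite inE /=.
  apply/andP; split.
    apply/ffun_onP => i; rewrite ffunE !inE imset_f // andbT.
    apply/imsetP => -[j _]; rewrite -rhor ffunE.
    by move=> /(rhoI (inr i) (inl j)).
  by apply/injectiveP => i j; rewrite !ffunE => /(rhoI (inr i) (inr j)) [].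
rewrite -cardB -sum_nat_const; apply: eq_bigr => b; rewrite inE => /andP[bO /injectiveP bI].
have {}bO i : b i \in O by apply: (ffun_onP bO).
pose F (x : J + 'I_k) : pred H :=
  match x with inl j => pred1 (r j) | inr i => mem (b i) end.
rewrite sum1dep_card; transitivity #|family F|.
  apply: eq_card => rho; rewrite inE [in LHS]inE; apply/idP/familyP.
    case/andP=> /andP[_ /eqP rE] /eqP bE [j|i] /=.
      by rewrite inE -rE ffunE.
    by rewrite -bE ffunE porbit_id.
  move=> rF.
  have rE : prefix_roots rho = r.
    by apply/ffunP => j; rewrite ffunE; apply/eqP; have := rF (inl j); rewrite inE.
  have bE : beta rho = b.
    apply/ffunP => i; rewrite ffunE; have := bO i; rewrite !inE.
    case/andP=> _ /imsetP[h _ hE]; have := rF (inr i); rewrite /= hE.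
    by move=> hr; apply/eqP; rewrite eq_porbit_mem.
  rewrite rE bE !eqxx !andbT; apply/injectiveP.
  have rE' j : rho (inl j) = r j by rewrite -rE ffunE.
  have bE' i : porbit sigma (rho (inr i)) = b i by rewrite -bE ffunE.
  have rb i j : porbit sigma (r j) = b i -> False.
    move=> rbE; have := bO i; rewrite inE -rbE => /andP[/negP[]].
    exact: imset_f.
  move=> [i|i] [j|j]; rewrite ?rE' ?bE'; first by move/rI ->.
  - by move/rb.
  - by move/esym/rb.
  - by move/bI ->.
rewrite card_family foldrE big_map big_enum /= big_sumType /=.
rewrite big1 ?mul1n => [|j _]; last exact: card1.
have -> : O = b @: setT.
  apply/eqP; rewrite eq_sym eqEcard cardO card_imset // cardsT card_ord leqnn.
  by rewrite andbT; apply/subsetP => _ /imsetP[i _ ->].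
rewrite big_imset /= => [|i j _ _]; last exact: bI.
by apply: eq_bigl => i; rewrite !inE.
Qed.

(** Both sides say that the cycles of the rho i are all the cycles of sigma. *)
Lemma distinct_cycles_cover (I : finType) sigma (rho : {ffun I -> H}) :
  distinct_cycles sigma rho ->
  (#|porbits sigma| == #|I|) = (\sum_i #|porbit sigma (rho i)| == #|H|).
Proof.
move=> /injectiveP rI; pose R := [set porbit sigma (rho i) | i : I].
have sR : R \subset porbits sigma.
  by apply/subsetP => _ /imsetP[j _ ->]; apply: imset_f.
have sumE : \sum_i #|porbit sigma (rho i)| = \sum_(c in R) #|c|.
  by rewrite big_imset //= => i j _ _; apply: rI.
have cardR : #|R| = #|I| by rewrite card_imset.
have cardE := cardsID R (porbits sigma); rewrite (setIidPr sR) cardR in cardE.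
have sumD : \sum_(c in R) #|c| + \sum_(c in porbits sigma :\: R) #|c| = #|H|.
  by rewrite -(sum_card_porbits sigma) [RHS](big_setID R) /= (setIidPr sR).
have -> : (#|porbits sigma| == #|I|) = (#|porbits sigma :\: R| == 0) by lia.
rewrite sumE.
have -> : (\sum_(c in R) #|c| == #|H|) =
  (\sum_(c in porbits sigma :\: R) #|c| == 0) by lia.
rewrite cards_eq0 sum_nat_eq0; apply/eqP/forall_inP => [-> c|d0].
  by rewrite inE.
apply/setP => c; rewrite [RHS]inE; apply/negP => cD.
have := d0 c cD; rewrite cards_eq0.
move: cD; rewrite inE => /andP[_ /imsetP[h _ ->]].
by apply/negP/set0Pn; exists h; apply: porbit_id.
Qed.

End RootCompletion.

(** * Labelled trees with some rooted vertices *)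

(** The bound s on the parts does not restrict a composition of s. *)
Lemma card_weak_compositions k s :
  #|[set f : {ffun 'I_k -> 'I_s.+1} | \sum_i (f i : nat) == s]| =
  if k is k'.+1 then 'C(k' + s, k') else (s == 0).
Proof.
case: k => [|k].
  rewrite (eq_card (B := [pred f : {ffun 'I_0 -> 'I_s.+1} | 0 == s])); last first.
    by move=> f; rewrite !inE big_ord0.
  case: s => [|s]; last by rewrite card0.
  by rewrite (eq_card (B := predT)) // card_ffun !card_ord expn0.
rewrite -card_ord_partitions.
pose tf (f : {ffun 'I_k.+1 -> 'I_s.+1}) := [tuple f i | i < k.+1].
have tfI : injective tf.
  move=> f g eq_fg; apply/ffunP => i.
  by have := congr1 (fun t => tnth t i) eq_fg; rewrite !tnth_mktuple.
rewrite -(card_imset _ tfI); apply: eq_card => t.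
rewrite [RHS]inE big_tuple; apply/imsetP/idP => [[f]|ts].
  rewrite inE => /eqP fs ->; apply/eqP; rewrite -[RHS]fs.
  by apply: eq_bigr => i _; rewrite tnth_mktuple.
exists [ffun i => tnth t i].
  rewrite inE; apply/eqP; rewrite -[RHS](eqP ts).
  by apply: eq_bigr => i _; rewrite ffunE.
by apply: eq_from_tnth => i; rewrite tnth_mktuple ffunE.
Qed.

Section CountRootedTrees.

Variables (J H : finType) (k : nat) (delta : J -> nat).

(** The cycles indexed by J have prescribed lengths; the k other ones are
    rooted but have arbitrary lengths. *)
Definition completed_cycles :=
  [set sr : {perm H} * {ffun J + 'I_k -> H} |
    [&& #|porbits sr.1| == #|J| + k, distinct_cycles sr.1 sr.2
      & [forall j, #|porbit sr.1 (sr.2 (inl j))| == delta j]]].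

Lemma completed_cyclesP sr : sr \in completed_cycles ->
  [/\ distinct_cycles sr.1 sr.2, forall j, #|porbit sr.1 (sr.2 (inl j))| = delta j
    & \sum_j delta j + \sum_i #|porbit sr.1 (sr.2 (inr i))| = #|H|].
Proof.
rewrite inE => /and3P[cards dc /forallP d]; split=> // [j|]; first exact/eqP.
move: cards; have <- : #|{: J + 'I_k}| = #|J| + k by rewrite card_sum card_ord.
rewrite (distinct_cycles_cover dc) big_sumType /= => /eqP <-; congr (_ + _).
by apply: eq_bigr => j _; rewrite (eqP (d j)).
Qed.

Lemma sum_card_new_cycles sigma (rho : {ffun J + 'I_k -> H}) :
  \sum_i #|porbit sigma (rho (inr i))| =
  \sum_i #|porbit sigma (rho (inr i))|.-1 + k.
Proof.
rewrite -[X in _ + X]card_ord -sum1_card -big_split /=; apply: eq_bigr => i _; rewrite addn1 prednK //.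
by rewrite card_gt0; apply/set0Pn; exists (rho (inr i)); apply: porbit_id.
Qed.

Lemma completed_cycles_eq0 :
  #|H| < \sum_j delta j + k -> #|completed_cycles| = 0.
Proof.
move=> ltH; apply: eq_card0 => sr; apply/negP => /completed_cyclesP[_ _].
by rewrite sum_card_new_cycles; lia.
Qed.

(** Each choice of the lengths f i + 1 of the k free cycles accounts for #|H|!
    permutations; s is what remains for the f i. *)
Lemma card_completed_cycles s : (forall j, 0 < delta j) ->
  \sum_j delta j + k + s = #|H| ->
  #|completed_cycles| =
  #|[set f : {ffun 'I_k -> 'I_s.+1} | \sum_i (f i : nat) == s]| * #|H|`!.
Proof.
move=> d_gt0 sumH; set C := [set f | _].
pose deg (sr : {perm H} * {ffun J + 'I_k -> H}) : {ffun 'I_k -> 'I_s.+1} :=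
  [ffun i => inord #|porbit sr.1 (sr.2 (inr i))|.-1].
have sumE sr : sr \in completed_cycles ->
    \sum_i #|porbit sr.1 (sr.2 (inr i))|.-1 = s.
  move=> /completed_cyclesP[_ _]; rewrite sum_card_new_cycles => E.
  by apply: (@addnI (\sum_j delta j + k)); rewrite sumH -E -addnA [k + _]addnC.
have degE sr i : sr \in completed_cycles ->
    (deg sr i).+1 = #|porbit sr.1 (sr.2 (inr i))|.
  move=> srY; rewrite ffunE inordK ?ltnS -?(sumE sr srY).
    by rewrite prednK // card_gt0; apply/set0Pn; exists (sr.2 (inr i)); apply: porbit_id.
  by rewrite (bigD1 i) //= leq_addr.
rewrite -sum1_card (partition_big deg (fun f => f \in C)) => [|sr srY]; last first.
  rewrite inE -[X in _ == X](sumE sr srY); apply/eqP/eq_bigr => i _.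
  by rewrite -degE.
rewrite -sum_nat_const; apply: eq_bigr => f; rewrite inE => /eqP fs.
pose d (x : J + 'I_k) := match x with inl j => delta j | inr i => (f i).+1 end.
have sumd : \sum_x d x = #|H|.
  rewrite big_sumType /= -sumH -addnA; congr (_ + _).
  under eq_bigr => i _ do rewrite -addn1.
  by rewrite big_split /= fs sum1_card card_ord addnC.
rewrite sum1dep_card -(@card_rooted_cycles _ H d) //; last by case.
apply: eq_card => sr; rewrite [LHS]inE; apply/andP/idP => [[srY /eqP dE]|].
  have [dc dJ _] := completed_cyclesP srY; rewrite inE dc; apply/forallP => -[j|i] /=.
    by rewrite dJ.
  by rewrite -degE // dE.
rewrite inE => /andP[dc /forallP sd].
have srY : sr \in completed_cycles.
  rewrite inE dc; apply/andP; split; last by apply/forallP => j; apply: (sd (inl j)).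
  have <- : #|{: J + 'I_k}| = #|J| + k by rewrite card_sum card_ord.
  by rewrite (distinct_cycles_cover dc) -sumd; apply/eqP/eq_bigr => x _; apply/eqP.
split=> //; apply/eqP/ffunP => i; apply/val_inj/succn_inj; rewrite /= degE //.
by apply/eqP; apply: (sd (inr i)).
Qed.

Definition labelled_trees e :=
  [set x : {perm H} * ({perm H} * {ffun J -> H}) |
    plane_tree e x.1 x.2.1 & x.2 \in rooted_cycles H delta].

(** Double count of the triples (alpha, sigma, rho) where rho roots all the
    vertices: completing the roots costs k! times the degrees of the free
    vertices, and the weight of sigma is the product of all degrees. *)
Lemma card_labelled_trees e : 0 < e -> #|H| = e.*2 -> #|J| + k = e.+1 ->
  #|labelled_trees e| * k`! =
  e.-1`! * \prod_j delta j * #|completed_cycles|.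
Proof.
move=> e0 cardH cardJ.
pose R := [set sr in rooted_cycles H delta | #|porbits sr.1| == e.+1].
have -> : #|labelled_trees e| =
    \sum_(sr in R) #|[set alpha | plane_tree e alpha sr.1]|.
  rewrite -sum1_card (partition_big (fun x => x.2) (fun sr => sr \in R)).
    apply: eq_bigr => sr; rewrite inE => /andP[srR _].
    rewrite sum1dep_card; have pI : injective (fun a : {perm H} => (a, sr)).
      by move=> a b [].
    rewrite -[RHS](card_imset _ pI); apply: eq_card => -[a sr'].
    rewrite [LHS]inE; apply/andP/imsetP => /= [[/[!inE]/= /andP[pt _] /eqP <-]|].
      by exists a; rewrite ?inE.
    by case=> b /[1!inE] pt [-> ->]; split=> //; rewrite inE pt /= srR.
  move=> [a sr]; rewrite inE => /andP[]; rewrite plane_tree_spanning /=.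
  by case/and4P=> _ _ ps _ srR; rewrite inE srR.
rewrite big_distrl /=.
rewrite -[#|completed_cycles|]sum1_card.
pose pre (sr : {perm H} * {ffun J + 'I_k -> H}) := (sr.1, prefix_roots sr.2).
have preR sr : sr \in completed_cycles -> pre sr \in R.
  move=> srY; have [dc dJ _] := completed_cyclesP srY.
  move: srY; rewrite !inE cardJ => /and3P[-> _ _]; rewrite andbT.
  rewrite distinct_cycles_prefix //=; apply/forallP => j.
  by rewrite ffunE dJ.
rewrite (partition_big pre (fun sr => sr \in R)) // big_distrr /=.
apply: eq_bigr => -[s r]; rewrite !inE /= => /andP[/andP[dc /forallP dJ] /eqP cs].
rewrite (card_plane_trees e0 cardH cs) -!mulnA; congr (_ * _); rewrite mulnC.
rewrite -(card_completions dc) ?cardJ // mulnC; congr (_ * _).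
  by apply: eq_bigr => j _; apply/eqP.
rewrite sum1dep_card; have pI : injective (fun rho : {ffun J + 'I_k -> H} => (s, rho)).
  by move=> a b [].
rewrite -(card_imset _ pI); apply: eq_card => -[s' rho].
apply/imsetP/idP => [[rho']|].
  rewrite inE => /andP[dc' /eqP rE] [-> ->].
  rewrite !inE /= cs cardJ dc' /pre /= rE !eqxx !andbT; apply/forallP => j.
  by rewrite -(eqP (dJ j)) -rE ffunE.
rewrite [_ \in [set x in _ | _]]inE => /andP[srY /eqP[sE rE]].
have [dc' _ _] := completed_cyclesP srY.
by exists rho; rewrite ?inE -?sE ?dc' -?rE ?eqxx.
Qed.

End CountRootedTrees.

(** * From labelled trees to isomorphism classes *)

Section Relabelling.

Variable H : finType.
Implicit Types (G : rooted_map H) (phi alpha sigma : {perm H}).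

Definition relabel phi G : rooted_map H :=
  RootedMap (edge_perm G ^ phi)%g (vertex_perm G ^ phi)%g
    (phi (Defs.root1 G)) (phi (root2 G)) (phi (root3 G)).

Lemma rooted_map_eq G G' : edge_perm G = edge_perm G' ->
  vertex_perm G = vertex_perm G' -> Defs.root1 G = Defs.root1 G' -> root2 G = root2 G' ->
  root3 G = root3 G' -> G = G'.
Proof. by case: G G' => a s r1 r2 r3 [a' s' r1' r2' r3'] /= -> -> -> -> ->. Qed.

Lemma rooted_iso_relabel phi G : rooted_iso G (relabel phi G).
Proof.
by exists phi; [exists (phi^-1)%g; [exact: permK|exact: permKV]|split=> // h; rewrite permJ].
Qed.

Lemma rooted_iso_relabelP G G' : rooted_iso G G' -> exists phi, G' = relabel phi G.
Proof.
case=> f /bij_inj fI [fa fs f1 f2 f3]; exists (perm fI).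
apply: rooted_map_eq; rewrite /= ?permE //; apply/permP => h;
  by rewrite -[h](permKV (perm fI)) permJ !permE ?fa ?fs.
Qed.

Lemma porbitJ sigma phi h : porbit (sigma ^ phi)%g (phi h) = phi @: porbit sigma h.
Proof.
apply/setP => k; apply/porbitP/imsetP => [[n ->]|[_ /porbitP[n ->] ->]].
  by exists ((sigma ^+ n)%g h); rewrite ?mem_porbit // -conjXg permJ.
by exists n; rewrite -conjXg permJ.
Qed.

Lemma porbitsJ sigma phi :
  porbits (sigma ^ phi)%g = [set phi @: (c : {set H}) | c in porbits sigma].
Proof.
apply/setP => c; apply/imsetP/imsetP => [[h _ ->]|[_ /imsetP[h _ ->] ->]].
  by exists (porbit sigma (phi^-1 h)%g); rewrite ?imset_f // -porbitJ permKV.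
by exists (phi h); rewrite // porbitJ.
Qed.

Lemma imset_perm_inj phi : injective (fun A : {set H} => phi @: A).
Proof. exact/imset_inj/perm_inj. Qed.

(** Only transitivity needs an argument: the preimage under phi of an orbit of
    the conjugated group is invariant under alpha and sigma. *)
Lemma plane_treeJ e alpha sigma phi :
  plane_tree e (alpha ^ phi)%g (sigma ^ phi)%g = plane_tree e alpha sigma.
Proof.
wlog suff imp : alpha sigma phi / plane_tree e alpha sigma ->
    plane_tree e (alpha ^ phi)%g (sigma ^ phi)%g.
  apply/idP/idP; last exact: imp.
  by move/(imp _ _ (phi^-1)%g); rewrite !conjgK.
case/and5P=> e0 cardH /forallP aK /forallP aN /andP[tr cs].
rewrite /plane_tree e0 cardH porbitsJ card_imset ?cs //; last exact: imset_perm_inj.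
rewrite andbT /=; apply/and3P; split.
- by apply/forallP => h; rewrite -[h](permKV phi) !permJ (eqP (aK _)).
- apply/forallP => h; rewrite -[h](permKV phi) permJ.
  by rewrite (inj_eq (@perm_inj _ _)) aN.
- have H0 : 0 < #|H| by rewrite (eqP cardH) double_gt0.
  have /card_gt0P[x0 _] := H0.
  apply/imsetP; exists x0; first by [].
  apply/eqP; rewrite eq_sym -subTset; apply/subsetP => h _.
  set O := orbit _ _ _.
  have OE : [set k | phi k \in O] = setT.
    apply: (transitive_closed (x := (phi^-1)%g x0) tr).
    + by rewrite inE permKV orbit_refl.
    + move=> k; rewrite !inE -permJ; apply: orbit_group_closed.
      by rewrite mem_gen ?inE ?eqxx.
    + move=> k; rewrite !inE -permJ; apply: orbit_group_closed.
      by rewrite mem_gen ?inE ?eqxx ?orbT.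
  by have /setP/(_ ((phi^-1)%g h)) := OE; rewrite !inE permKV => ->.
Qed.

Lemma root_vertices_relabel phi G :
  root_vertices (relabel phi G) = [seq phi @: (V : {set H}) | V <- root_vertices G].
Proof. by rewrite /root_vertices /= !porbitJ. Qed.

Lemma three_rooted_treeJ e phi G :
  three_rooted_tree e (relabel phi G) = three_rooted_tree e G.
Proof.
rewrite /three_rooted_tree plane_treeJ root_vertices_relabel map_inj_uniq //.
exact: imset_perm_inj.
Qed.

(** Rooted trees are rigid: two relabellings with the same result agree at the
    root, hence on its orbit. *)
Lemma relabel_inj e G : plane_tree e (edge_perm G) (vertex_perm G) ->
  injective (relabel^~ G).
Proof.
case/and5P=> _ _ _ _ /andP[tr _] phi psi [aE sE r1E _ _].
have : [set h | phi h == psi h] = setT.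
  apply: (transitive_closed (x := Defs.root1 G) tr); first by rewrite inE r1E.
    by move=> h; rewrite !inE => /eqP hE; rewrite -(permJ _ phi) -(permJ _ psi) aE hE.
  by move=> h; rewrite !inE => /eqP hE; rewrite -(permJ _ phi) -(permJ _ psi) sE hE.
by move/setP=> E; apply/permP => h; have := E h; rewrite !inE => /eqP.
Qed.

End Relabelling.

(** The isomorphism class of G is the set of its relabellings, which are
    pairwise distinct. *)
Lemma card_three_rooted_trees e d1 d2 d3 :
  #|three_rooted_trees e d1 d2 d3| =
  num_three_rooted_trees e d1 d2 d3 * (e.*2)`!.
Proof.
set D := three_rooted_trees _ _ _ _.
apply: card_uniform_partition; last first.
  exact/equivalence_partitionP/rooted_iso_equivalence.
move=> _ /imsetP[G GD ->].
have /andP[pt _] : three_rooted_tree e G by move: GD; rewrite inE => /andP[].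
rewrite -card_Sn -cardsT.
rewrite -(card_imset _ (relabel_inj pt)); apply: eq_card => G'.
rewrite inE; apply/andP/imsetP => [[_ /asboolP/rooted_iso_relabelP[phi ->]]|].
  by exists phi.
case=> phi _ ->; split; last exact/asboolP/rooted_iso_relabel.
move: GD; rewrite !inE three_rooted_treeJ root_vertices_relabel => /andP[-> /eqP <-].
rewrite -map_comp; apply/eqP/eq_map => A /=; apply/card_imset/perm_inj.
Qed.

Lemma card_three_rooted_labelled e d1 d2 d3 :
  #|three_rooted_trees e d1 d2 d3| =
  #|labelled_trees 'I_(e.*2) (fun j : 'I_3 => nth 0 [:: d1; d2; d3] j) e|.
Proof.
pose f (G : rooted_map 'I_(e.*2)) := (edge_perm G, (vertex_perm G,
  [ffun j : 'I_3 => nth (Defs.root1 G) [:: Defs.root1 G; root2 G; root3 G] j])).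
have fI : injective f.
  move=> G G' [aE sE /ffunP rE]; apply: rooted_map_eq => //.
  - by have := rE (@Ordinal 3 0 isT); rewrite !ffunE.
  - by have := rE (@Ordinal 3 1 isT); rewrite !ffunE.
  - by have := rE (@Ordinal 3 2 isT); rewrite !ffunE.
have fE G : (f G \in labelled_trees _ (fun j : 'I_3 => nth 0 [:: d1; d2; d3] j) e) =
    (G \in three_rooted_trees e d1 d2 d3).
  rewrite !inE /three_rooted_tree /= -andbA; congr (_ && (_ && _)).
    rewrite /distinct_cycles /injectiveb /dinjectiveb !enum_ordSl.
    by rewrite (size0nil (size_enum_ord 0)) /= !ffunE.
  apply/forallP/eqP => [dE|[<- <- <-] j].
    have := (dE (@Ordinal 3 0 isT), dE (@Ordinal 3 1 isT), dE (@Ordinal 3 2 isT)).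
    by rewrite /= !ffunE /= => -[[/eqP -> /eqP ->] /eqP ->].
  by rewrite ffunE; case: j => -[|[|[|]]].
rewrite -(card_imset _ fI); apply: eq_card => -[a [s r]].
apply/imsetP/idP => [[G GT ->]|xT]; first by rewrite fE.
pose G := RootedMap a s (r (@Ordinal 3 0 isT)) (r (@Ordinal 3 1 isT))
  (r (@Ordinal 3 2 isT)).
have xE : (a, (s, r)) = f G.
  congr (_, (_, _)); apply/ffunP => -[j ltj]; rewrite ffunE.
  by case: j ltj => [|[|[|]]] //= ltj; congr (r _); apply: val_inj.
by exists G; rewrite -?fE -?xE.
Qed.

(** * The number of three-rooted trees *)

(** For m > 0, the number of weak compositions of m - j into m - 1 parts; the
    truncated subtractions give 1 at j = m, also when m is 0 or 1, which is the
    value that makes [excess_series_rec] true at the boundary. *)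
Definition excess_compositions j m := if j <= m then 'C(m.*2 - j - 2, m - j) else 0.

Lemma card_excess_compositions j m : j <= m.+1 ->
  #|[set f : {ffun 'I_m -> 'I_(m.+1 - j).+1} | \sum_i (f i : nat) == m.+1 - j]| =
  excess_compositions j m.+1.
Proof.
move=> le_jm; rewrite card_weak_compositions /excess_compositions le_jm.
case: m le_jm => [|m] le_jm; first by case: j le_jm => [|[]].
have -> : m.+2.*2 - j - 2 = m + (m.+2 - j) by lia.
by rewrite -[in RHS]bin_sub ?leq_addl // addnK.
Qed.

Lemma num_three_rooted_trees_lt2 e d1 d2 d3 : e < 2 ->
  num_three_rooted_trees e d1 d2 d3 = 0.
Proof.
move=> e2; apply/eqP; rewrite -[_ == 0](eqn_pmul2r (fact_gt0 e.*2)) mul0n.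
rewrite -card_three_rooted_trees cards_eq0; apply/eqP/setP => G; rewrite !inE.
apply/negP => /andP[/andP[/and5P[_ _ _ _ /andP[_ /eqP cs]] uG] _].
have : size (root_vertices G) <= #|porbits (vertex_perm G)|.
  rewrite cardE; apply: uniq_leq_size => // V.
  rewrite mem_enum /root_vertices map_cons /= !inE.
  by case/or3P=> /eqP ->; apply: imset_f.
by rewrite cs /=; lia.
Qed.

Lemma num_three_rooted_trees_deg0 e d1 d2 d3 : d1 * d2 * d3 = 0 ->
  num_three_rooted_trees e d1 d2 d3 = 0.
Proof.
move=> d0; apply/eqP; rewrite -[_ == 0](eqn_pmul2r (fact_gt0 e.*2)) mul0n.
rewrite -card_three_rooted_trees cards_eq0; apply/eqP/setP => G; rewrite !inE.
apply/negP => /andP[_ /eqP[dE1 dE2 dE3]]; move: d0; rewrite -dE1 -dE2 -dE3.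
have porbit_gt0 h : 0 < #|porbit (vertex_perm G) h|.
  by rewrite card_gt0; apply/set0Pn; exists h; apply: porbit_id.
by apply/eqP; rewrite -lt0n !muln_gt0 !porbit_gt0.
Qed.

(** With e = m + 1 edges, the m - 1 other vertices have degrees 1 + f i, where
    the f i sum to 2e - (a + b + c + 3) - (m - 1) = m - (a + b + c). *)
Lemma num_three_rooted_treesE m a b c :
  num_three_rooted_trees m.+1 a.+1 b.+1 c.+1 =
  m * (a.+1 * b.+1 * c.+1) * excess_compositions (a + b + c) m.
Proof.
case: m => [|m]; first by rewrite num_three_rooted_trees_lt2.
pose delta (j : 'I_3) := nth 0 [:: a.+1; b.+1; c.+1] j.
have sum_delta : \sum_j delta j = a + b + c + 3.
  by rewrite !big_ord_recl big_ord0 /delta /=; lia.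
have prod_delta : \prod_j delta j = a.+1 * b.+1 * c.+1.
  by rewrite !big_ord_recl big_ord0 /delta /= muln1 mulnA.
have := @card_labelled_trees _ 'I_(m.+2.*2) m delta m.+2.
rewrite !card_ord => /(_ isT erefl erefl).
rewrite -card_three_rooted_labelled card_three_rooted_trees prod_delta /=.
have [ltjm|lejm] := ltnP m.+1 (a + b + c).
  rewrite completed_cycles_eq0 ?card_ord ?sum_delta; last by lia.
  move/eqP; rewrite muln0 !muln_eq0 !(gtn_eqF (fact_gt0 _)) !orbF => /eqP ->.
  by rewrite /excess_compositions leqNgt ltjm muln0.
rewrite (@card_completed_cycles _ _ _ _ (m.+1 - (a + b + c))); first last.
- by rewrite card_ord sum_delta; lia.
- by move=> -[[|[|[|]]]].
rewrite card_ord card_excess_compositions // factS => E.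
apply/eqP; rewrite -(eqn_pmul2r (fact_gt0 m)) -(eqn_pmul2r (fact_gt0 m.+2.*2)).
by apply/eqP; rewrite mulnAC E; lia.
Qed.

Local Open Scope ring_scope.

(** * Power series *)

Section FpsDerivation.

Variable R : comNzRingType.
Implicit Types f g : {fps R}.

Definition fps_deriv f : {fps R} := \fps_n (n.+1%:R * f n.+1).

Lemma fps_derivD f g : fps_deriv (f + g) = fps_deriv f + fps_deriv g.
Proof. by apply/fpsP => n; rewrite /= mulrDr. Qed.

Lemma fps_derivN f : fps_deriv (- f) = - fps_deriv f.
Proof. by apply/fpsP => n; rewrite /= mulrN. Qed.

Lemma fps_derivM f g : fps_deriv (f * g) = fps_deriv f * g + f * fps_deriv g.
Proof.
apply/fpsP => n; rewrite fps_coefD.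
(* The factor n + 1 of the derivative is split as i + (n + 1 - i). *)
transitivity (\sum_(i < n.+2) i%:R * f i * g (n.+1 - i)%N +
              \sum_(i < n.+2) f i * ((n.+1 - i)%:R * g (n.+1 - i)%N)).
  rewrite -big_split -[LHS]/(_ * \sum_(i < n.+2) _) big_distrr /=.
  apply: eq_bigr => i _; rewrite [f i * (_ * _)]mulrCA !mulrA -!mulrDl -natrD.
  by rewrite subnKC // -ltnS.
rewrite big_ord_recl !mul0r add0r [X in _ + X]big_ord_recr /= subnn mul0r mulr0.
rewrite addr0; congr (_ + _); apply: eq_bigr => i _ //=.
by rewrite subSn // -ltnS.
Qed.

Lemma fps_derivC (c : R) : fps_deriv c%:S = 0.
Proof. by apply/fpsP => n; rewrite /= mulr0. Qed.

Lemma fps_deriv_nat n : fps_deriv n%:R = 0.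
Proof. by rewrite -(rmorph_nat (@fpsC R)) fps_derivC. Qed.

Lemma fps_derivX : fps_deriv (fpsX R) = 1.
Proof.
apply/fpsP => -[|n]; rewrite fps_coef1 /= ?mul1r //.
by rewrite mulr0.
Qed.

Definition fps_derivE := (fps_derivD, fps_derivN, fps_derivM, fps_derivC,
  fps_deriv_nat, fps_derivX).

Lemma fps_coefX_deriv f m : (fpsX R * fps_deriv f) m = m%:R * f m.
Proof. by rewrite fps_coefXM; case: m => [|m] //; rewrite mul0r. Qed.

Lemma fps_coefCM (c : R) f n : (c%:S * f) n = c * f n.
Proof.
rewrite fps_coefM big_ord_recl subn0 /= big1 ?addr0 // => i _.
by rewrite mul0r.
Qed.

Lemma fps_coef_nat n m : (n%:R : {fps R}) m = if m == 0%N then n%:R else 0.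
Proof. by rewrite -(rmorph_nat (@fpsC R)). Qed.

Lemma fps_coefXnM_lt f k n : (n < k)%N -> (fpsX R ^+ k * f) n = 0.
Proof.
elim: k n => // k IHk n; rewrite exprS -mulrA fps_coefXM.
by case: n => // n; apply: IHk.
Qed.

Lemma fps_mulX_inj : injective (fun f => fpsX R * f).
Proof.
move=> f g /fpsP fg; apply/fpsP => n.
by have := fg n.+1; rewrite !fps_coefXM.
Qed.

End FpsDerivation.

Section TreeSeries.

Variable R : comUnitRingType.
Hypothesis natU : forall n, n.+1%:R \is a @GRing.unit R.

Local Notation t := (fpsX R).

Lemma fps_natU n : n.+1%:R \is a @GRing.unit {fps R}.
Proof. by rewrite fps_unitE fps_coef_nat natU. Qed.

Lemma fps_deriv_eq0 (f : {fps R}) : fps_deriv f = 0 -> f = (f 0%N)%:S.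
Proof.
move=> /fpsP f'0; apply/fpsP => -[|n] //=.
by apply: (mulrI (natU n)); rewrite mulr0; apply: f'0.
Qed.

Variable y : {fps R}.
Hypotheses (y_sqr : y ^+ 2 = 1 - 4 * t) (y_0 : y 0%N = 1).

Lemma sqrt_unit : y \is a GRing.unit.
Proof. by rewrite fps_unitE y_0 unitr1. Qed.

Lemma sqrt_deriv : y * fps_deriv y = - 2.
Proof.
have := congr1 (@fps_deriv R) y_sqr.
rewrite expr2 -[1]/(1%:R) !fps_derivE => E.
apply: (mulrI (fps_natU 1)).
transitivity (fps_deriv y * y + y * fps_deriv y); first by ring.
by rewrite E; ring.
Qed.

(** The expansion of 1 / y, identified by its differential equation. *)
Definition central_binomials : {fps R} := \fps_n 'C(n.*2, n)%:R.

Lemma central_binomial_rec n : (n.+1 * 'C(n.+1.*2, n.+1) = 2 * n.*2.+1 * 'C(n.*2, n))%N.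
Proof.
have E1 : (n.+1 * 'C(n.*2.+2, n.+1) = n.*2.+2 * 'C(n.*2.+1, n))%N.
  by rewrite -mul_bin_diag.
have E2 : (n.+1 * 'C(n.*2.+1, n) = n.*2.+1 * 'C(n.*2, n))%N.
  have := mul_bin_left n.*2.+1 n; rewrite -mul_bin_diag /=.
  by rewrite (_ : (n.*2.+1 - n = n.+1)%N) //; lia.
rewrite doubleS E1 (_ : n.*2.+2 = 2 * n.+1)%N; last by lia.
by rewrite -!mulnA E2.
Qed.

Lemma central_binomials_deriv :
  (1 - 4 * t) * fps_deriv central_binomials = 2 * central_binomials.
Proof.
have cn n (f : {fps R}) m : (n%:R * f) m = n%:R * f m.
  by rewrite -(rmorph_nat (@fpsC R)) fps_coefCM.
apply/fpsP => n; rewrite mulrBl mul1r -mulrA fps_coefB !cn fps_coefXM.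
have -> : fps_deriv central_binomials n = (2 * n.*2.+1 * 'C(n.*2, n))%:R.
  by rewrite /= -natrM central_binomial_rec.
case: n => [|n]; first by rewrite mulr0 subr0 /= -natrM.
rewrite /fps_deriv /central_binomials /=.
set b := 'C(_, _); rewrite -!natrM; apply/eqP; rewrite subr_eq -natrD.
by apply/eqP; congr _%:R; lia.
Qed.

(** The derivative of the product vanishes, because
    y (y B)' = (y y') B + y^2 B' = - 2 B + (1 - 4 t) B'. *)
Lemma central_binomialsE : y * central_binomials = 1.
Proof.
have D0 : fps_deriv (y * central_binomials) = 0.
  apply: (mulrI sqrt_unit); rewrite mulr0 fps_derivE.
  transitivity (y * fps_deriv y * central_binomials +
     y ^+ 2 * fps_deriv central_binomials); first by ring.
  by rewrite y_sqr central_binomials_deriv sqrt_deriv; ring.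
rewrite (fps_deriv_eq0 D0) fps_coefM0 y_0 mul1r /= bin0.
by [].
Qed.

(** t times the Catalan series: the root u of u (1 - u) = t without constant
    term. It is locked to keep rewriting from seeing its expression in y. *)
Definition tree_series : {fps R} := locked (2^-1 * (1 - y)).

Local Notation u := tree_series.

Lemma tree_seriesE : u = 2^-1 * (1 - y).
Proof. by rewrite /tree_series -lock. Qed.

Lemma sqrt_tree_series : y = 1 - 2 * u.
Proof. by rewrite tree_seriesE mulrA divrr ?fps_natU // mul1r opprB addrC subrK. Qed.

Lemma fpsX_tree_series : t = u * (1 - u).
Proof.
apply: (mulrI (fps_natU 3)).
transitivity (1 - y ^+ 2); first by rewrite y_sqr; ring.
by rewrite sqrt_tree_series; ring.
Qed.

Lemma tree_series0 : u 0%N = 0.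
Proof.
rewrite tree_seriesE fps_coefM0 fps_coefB y_0.
by rewrite subrr mulr0.
Qed.

Lemma onem_tree_series_unit : 1 - u \is a GRing.unit.
Proof. by rewrite fps_unitE fps_coefB tree_series0 subr0 unitr1. Qed.

Lemma tree_series_fpsX : u = t * (1 - u)^-1.
Proof. by rewrite fpsX_tree_series mulrK // onem_tree_series_unit. Qed.

Lemma tree_series_deriv : y * fps_deriv u = 1.
Proof.
apply: (mulrI (fps_natU 1)); have := sqrt_deriv.
rewrite {2}sqrt_tree_series -[1]/(1%:R) !fps_derivE => E.
by rewrite -[2 in RHS]opprK -E; ring.
Qed.

Definition excess_series j : {fps R} := \fps_m (excess_compositions j m)%:R.

(** Pascal's rule. *)
Lemma excess_series_rec j :
  excess_series j.+1 = excess_series j.+2 + t * excess_series j.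
Proof.
apply/fpsP => -[|m]; rewrite fps_coefD fps_coefXM /= /excess_compositions.
  by rewrite !ltn0 addr0.
rewrite !ltnS -natrD; congr _%:R; case: (ltngtP j m) => [ltjm|//|->].
- have -> : (m.+1.*2 - j.+1 - 2 = (m.*2 - j - 2).+1)%N by lia.
  have -> : (m.+1.*2 - j.+2 - 2 = m.*2 - j - 2)%N by lia.
  have -> : (m.+1 - j.+1 = (m.+1 - j.+2).+1)%N by lia.
  have -> : (m - j = (m.+1 - j.+2).+1)%N by lia.
  by rewrite binS addnC.
- by rewrite !subnn !bin0.
Qed.

Lemma excess_series2 : excess_series 2 = t ^+ 2 * central_binomials.
Proof.
apply/fpsP => n; rewrite expr2 -mulrA.
case: n => [|[|n]]; rewrite !fps_coefXM //= /excess_compositions /=.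
have -> : (n.+2.*2 - 2 - 2 = n.*2)%N by lia.
by rewrite subn2.
Qed.

Lemma excess_series1 : 2 * excess_series 1 = t * (1 + central_binomials).
Proof.
apply/fpsP => n; rewrite -(rmorph_nat (@fpsC R)) fps_coefCM fps_coefXM.
case: n => [|n]; first by rewrite /= mulr0.
rewrite fps_coefD fps_coef1 /= /excess_compositions.
case: n => [|n]; first by rewrite mulr1.
rewrite add0r -natrM; congr _%:R.
have -> : (n.+2.*2 - 1 - 2 = n.*2.+1)%N by lia.
have symC : 'C(n.*2.+1, n) = 'C(n.*2.+1, n.+1).
  by rewrite -[RHS]bin_sub; [congr 'C(_, _) | ]; lia.
by rewrite subn1 /= doubleS [in RHS]binS symC addnn mul2n.
Qed.

(** Since u^(j+1) = u^(j+2) + t u^j, both sides satisfy the same recurrence;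
    it is run upwards from 1 and 2, and once downwards to reach 0. *)
Lemma excess_series_closed j : y * excess_series j = u ^+ j * (1 - u) ^+ 2.
Proof.
have S2 : y * excess_series 2 = u ^+ 2 * (1 - u) ^+ 2.
  rewrite excess_series2 mulrCA central_binomialsE mulr1 {1}fpsX_tree_series.
  by rewrite exprMn.
have S1 : y * excess_series 1 = u ^+ 1 * (1 - u) ^+ 2.
  apply: (mulrI (fps_natU 1)).
  rewrite mulrCA excess_series1 mulrCA mulrDr mulr1 central_binomialsE.
  by rewrite {1}fpsX_tree_series {1}sqrt_tree_series; ring.
have S12 i : y * excess_series i.+1 = u ^+ i.+1 * (1 - u) ^+ 2 /\
             y * excess_series i.+2 = u ^+ i.+2 * (1 - u) ^+ 2.
  (* Pascal's rule read as S (j + 2) = S (j + 1) - t S j. *)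
  elim: i => [//|i [IH1 IH2]]; split=> //.
  have /esym/(canRL (addrK _)) -> := excess_series_rec i.+1.
  by rewrite mulrBr IH2 [y * (t * _)]mulrCA IH1 {1}fpsX_tree_series !exprS; ring.
case: j => [|j]; last by case: (S12 j).
(* Pascal's rule read as t S 0 = S 1 - S 2. *)
apply: fps_mulX_inj; rewrite mulrCA.
have /esym/(canRL (addKr _)) -> := excess_series_rec 0.
by rewrite mulrDr mulrN S2 S1 fpsX_tree_series; ring.
Qed.

Lemma sum_succ_geometric (S : comNzRingType) (w : S) N :
  (1 - w) ^+ 2 * (\sum_(a < N) a.+1%:R * w ^+ a) =
  1 - w ^+ N * (N.+1%:R - N%:R * w).
Proof.
elim: N => [|N IHN]; first by rewrite big_ord0 mulr0 expr0 mul1r mul0r subr0 mulr1n subrr.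
rewrite big_ord_recr /= mulrDr IHN (exprS w N) -!natr1.
move: (w ^+ N) (N%:R : S) => W n; ring.
Qed.

Local Notation Z X := (1 - X * u).

Section ThreeRoots.

Variables X1 X2 X3 : {fps R}.

Local Notation P := (Z X1 * Z X2 * Z X3).

Lemma root_factor_unit X : Z X \is a GRing.unit.
Proof. by rewrite fps_unitE fps_coefB fps_coefM0 tree_series0 mulr0 subr0 unitr1. Qed.

(** The sum of d X^d u^(d-1) over all d is X / (1 - X u)^2, and cutting it off
    costs a multiple of u^N, hence of t^N. *)
Lemma degree_series X N : exists h,
  \sum_(a < N) a.+1%:R * X ^+ a.+1 * u ^+ a = X * (Z X ^+ 2)^-1 + t ^+ N * h.
Proof.
(* The remainder is -(X u)^N (N + 1 - N X u) times X / (1 - X u)^2, where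
   u^N = t^N (1 - u)^-N. *)
exists (- X * (X * (1 - u)^-1) ^+ N * (N.+1%:R - N%:R * (X * u)) * (Z X ^+ 2)^-1).
have ZU : Z X ^+ 2 \is a GRing.unit by rewrite unitrX // root_factor_unit.
apply: (mulrI ZU).
have -> : \sum_(a < N) a.+1%:R * X ^+ a.+1 * u ^+ a =
    X * \sum_(a < N) a.+1%:R * (X * u) ^+ a.
  by rewrite big_distrr /=; apply: eq_bigr => a _; rewrite [in RHS]exprMn exprS [RHS]mulrCA !mulrA.
rewrite mulrCA sum_succ_geometric.
have -> : (X * u) ^+ N = t ^+ N * (X * (1 - u)^-1) ^+ N.
  by rewrite -exprMn {1}tree_series_fpsX; congr (_ ^+ N); ring.
move: (Z X ^+ 2)^-1 (divrr ZU) => i zi.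
transitivity (Z X ^+ 2 * i * (X * (1 - t ^+ N * (X * (1 - u)^-1) ^+ N *
  (N.+1%:R - N%:R * (X * u))))); first by rewrite zi mul1r.
by ring.
Qed.

(** The sum of d1 d2 d3 X1^d1 X2^d2 X3^d3 u^(d1+d2+d3-3) (1 - u)^2 / y over all
    degrees, in closed form; see [roots_series_coef]. *)
Definition roots_series : {fps R} :=
  X1 * X2 * X3 * (1 - u) ^+ 2 * (y * P ^+ 2)^-1.

Lemma root_factors_unit : P \is a GRing.unit.
Proof. by rewrite !unitrM !root_factor_unit. Qed.

Lemma roots_seriesE : roots_series * (y * P ^+ 2) = X1 * X2 * X3 * (1 - u) ^+ 2.
Proof. by rewrite /roots_series mulrVK // unitrM sqrt_unit unitrX // root_factors_unit. Qed.

Hypotheses (dX1 : fps_deriv X1 = 0) (dX2 : fps_deriv X2 = 0).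
Hypothesis dX3 : fps_deriv X3 = 0.

(** y P', in view of y u' = 1. *)
Let P1 := - (X1 * Z X2 * Z X3 + Z X1 * X2 * Z X3 + Z X1 * Z X2 * X3).

Let root_factors_deriv : y * fps_deriv P = P1.
Proof.
rewrite -[1]/(1%:R) !fps_derivE dX1 dX2 dX3 -[1%:R]/(1).
transitivity ((y * fps_deriv u) * P1); last by rewrite tree_series_deriv mul1r.
by rewrite /P1; ring.
Qed.

(** Differentiate [roots_seriesE] and multiply by y^2 P: the products y y' = - 2,
    y u' = 1 and y P' = P1 then remove all derivatives except that of the
    series itself, without any division. *)
Lemma roots_series_deriv : fps_deriv roots_series * (y ^+ 3 * P ^+ 3) =
  X1 * X2 * X3 * (1 - u) * (2 * u * P - 2 * (1 - u) * y * P1).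
Proof.
have D : fps_deriv roots_series * (y * P ^+ 2) +
    roots_series * (fps_deriv y * P ^+ 2 + y * (2 * P * fps_deriv P)) =
    - (2 * X1 * X2 * X3 * (1 - u) * fps_deriv u).
  have := congr1 (@fps_deriv R) roots_seriesE.
  rewrite fps_derivM [fps_deriv (y * _)]fps_derivM.
  have -> : fps_deriv (P ^+ 2) = 2 * P * fps_deriv P.
    by rewrite expr2 fps_derivM; ring.
  move=> ->; rewrite [(1 - u) ^+ 2]expr2 -[1]/(1%:R) !fps_derivE dX1 dX2 dX3.
  by rewrite -[1%:R]/(1); ring.
move: roots_seriesE root_factors_deriv sqrt_deriv tree_series_deriv D.
move: (fps_deriv roots_series) (fps_deriv P) (fps_deriv y) (fps_deriv u).
move: roots_series P P1 => M Q Q1 M' Q' y' u' ME Q'E y'E u'E D.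
transitivity ((M' * (y * Q ^+ 2) + M * (y' * Q ^+ 2 + y * (2 * Q * Q'))) *
  (y ^+ 2 * Q) - M * (y * Q ^+ 2) * (y * y' * Q + 2 * y * (y * Q'))).
  by ring.
rewrite D ME Q'E y'E.
transitivity (X1 * X2 * X3 * (1 - u) *
  (- (2 * (y * u') * y * Q) + 2 * (1 - u) * Q - 2 * (1 - u) * y * Q1)).
  by ring.
by rewrite u'E {1}sqrt_tree_series; ring.
Qed.

(** The denominators of the announced formula, in terms of u. *)
Lemma root_denominatorE X : 1 + y - 2 * t * X = 2 * (1 - u) * Z X.
Proof. by rewrite {1}fpsX_tree_series {1}sqrt_tree_series; ring. Qed.

(** After the common factor t^2 X1 X2 X3 (2 (1 - u))^10 is taken out, a
    polynomial identity in u and the X_i remains. *)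
Lemma roots_series_rational : t ^+ 2 * fps_deriv roots_series =
  (t ^+ 2 * X1 * X2 * X3 * (y + 1) ^+ 10)
    / (2 * y ^+ 3 * (1 + y - 2 * t * X1) ^+ 3
                  * (1 + y - 2 * t * X2) ^+ 3
                  * (1 + y - 2 * t * X3) ^+ 3)
  * (1 - y
     + (2 * y - 2 * t) * (X1 + X2 + X3)
     + 1 / 2 * (y - 1) * (1 + 3 * y - 6 * t) * (X1 * X2 + X1 * X3 + X2 * X3)
     + 1 / 4 * (y - 1) ^+ 2 * (2 + 4 * y - 10 * t) * (X1 * X2 * X3)).
Proof.
have half : 1 / 2 * (y - 1) = - u by rewrite tree_seriesE; ring.
have quarter : 1 / 4 * (y - 1) ^+ 2 = u ^+ 2.
  apply: (mulrI (fps_natU 3)); rewrite !mulrA mulr1 divrr ?fps_natU //.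
  by rewrite sqrt_tree_series; ring.
rewrite half quarter !root_denominatorE.
set D := 2 * y ^+ 3 * _ * _ * _.
have DU : D \is a GRing.unit.
  by rewrite /D !(unitrM, unitrX_pos) ?root_factor_unit ?onem_tree_series_unit ?sqrt_unit ?fps_natU.
apply: (mulIr DU); rewrite [RHS]mulrAC mulrVK //.
transitivity (t ^+ 2 * (fps_deriv roots_series * (y ^+ 3 * P ^+ 3)) *
  (1024 * (1 - u) ^+ 9)); first by rewrite /D; ring.
rewrite roots_series_deriv.
have -> : y + 1 = 2 * (1 - u) by rewrite {1}sqrt_tree_series; ring.
transitivity (t ^+ 2 * X1 * X2 * X3 * (2 * (1 - u)) ^+ 10 *
  (2 * u * P - 2 * (1 - u) * y * P1)).
  by move: P P1 => Q Q1; ring.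
by congr (_ * _); rewrite /P1 fpsX_tree_series sqrt_tree_series; ring.
Qed.

End ThreeRoots.

(** Modulo t^N the degrees may be bounded by N, which turns the series into a
    finite sum of the [excess_series]. *)
Lemma roots_series_coef (x1 x2 x3 : R) m N : (m < N)%N ->
  roots_series x1%:S x2%:S x3%:S m =
  \sum_(a < N) \sum_(b < N) \sum_(c < N)
    (a.+1 * b.+1 * c.+1 * excess_compositions (a + b + c) m)%:R *
    (x1 ^+ a.+1 * x2 ^+ b.+1 * x3 ^+ c.+1).
Proof.
move=> ltmN; pose E x := \sum_(a < N) a.+1%:R * x%:S ^+ a.+1 * u ^+ a.
have KU : y \is a GRing.unit := sqrt_unit.
pose K := (1 - u) ^+ 2 * y^-1.
have KuE j : K * u ^+ j = excess_series j.
  apply: (mulrI KU); rewrite excess_series_closed /K; move: (u ^+ j) => w.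
  transitivity (y * y^-1 * (w * (1 - u) ^+ 2)); first by ring.
  by rewrite divrr // mul1r.
transitivity ((K * (E x1 * E x2 * E x3)) m).
  have degE x : exists h, E x = x%:S * (Z x%:S ^+ 2)^-1 + t ^+ N * h.
    exact: degree_series.
  have [[h1 E1] [h2 E2] [h3 E3]] := And3 (degE x1) (degE x2) (degE x3).
  rewrite E1 E2 E3.
  have invP : (y * (Z x1%:S * Z x2%:S * Z x3%:S) ^+ 2)^-1 =
      y^-1 * ((Z x1%:S ^+ 2)^-1 * (Z x2%:S ^+ 2)^-1 * (Z x3%:S ^+ 2)^-1).
    by rewrite !exprMn !invrM ?unitrM ?unitrX ?root_factor_unit //; ring.
  rewrite /roots_series invP.
  set i1 := (Z x1%:S ^+ 2)^-1; set i2 := (Z x2%:S ^+ 2)^-1.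
  set i3 := (Z x3%:S ^+ 2)^-1.
  set B := x1%:S * i1; set C := x2%:S * i2; set D := x3%:S * i3.
  (* h collects the terms of the product that contain a remainder. *)
  pose h := K * (h1 * C * D + B * h2 * D + B * C * h3 + t ^+ N * h1 * h2 * D
    + t ^+ N * h1 * C * h3 + t ^+ N * B * h2 * h3
    + t ^+ N * t ^+ N * h1 * h2 * h3).
  transitivity ((K * (B * C * D) + t ^+ N * h) m); last first.
    by congr (fps_coef _ m); rewrite /h; move: (t ^+ N) => T; ring.
  rewrite fps_coefD fps_coefXnM_lt // addr0; congr (fps_coef _ m).
  by rewrite /K /B /C /D; ring.
have -> : K * (E x1 * E x2 * E x3) =
  \sum_(a < N) \sum_(b < N) \sum_(c < N)
    ((a.+1 * b.+1 * c.+1)%:R * (x1 ^+ a.+1 * x2 ^+ b.+1 * x3 ^+ c.+1))%:S *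
    excess_series (a + b + c).
  rewrite /E -mulrA big_distrl mulr_sumr; apply: eq_bigr => a _.
  rewrite big_distrl /= mulr_sumr mulr_sumr; apply: eq_bigr => b _.
  rewrite mulr_sumr mulr_sumr mulr_sumr; apply: eq_bigr => c _.
  rewrite -KuE !exprD !rmorphM /= !rmorphXn /= !rmorph_nat.
  move: (u ^+ a) (u ^+ b) (u ^+ c) => ua ub uc.
  move: (x1%:S ^+ a.+1) (x2%:S ^+ b.+1) (x3%:S ^+ c.+1) => xa xb xc.
  by rewrite !natrM; move: (a.+1%:R : {fps R}) (b.+1%:R : {fps R}) (c.+1%:R : {fps R}) => *; ring.
rewrite fps_coef_sum; apply: eq_bigr => a _; rewrite fps_coef_sum.
apply: eq_bigr => b _; rewrite fps_coef_sum; apply: eq_bigr => c _.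
by rewrite fps_coefCM /= [in RHS]natrM mulrAC.
Qed.

End TreeSeries.

(** * The generating function *)

Lemma sum_drop0 (V : zmodType) N (F : nat -> V) : F 0%N = 0 ->
  \sum_(d < N.+1) F d = \sum_(a < N) F a.+1.
Proof. by move=> F0; rewrite big_ord_recl F0 add0r. Qed.

Lemma gf_three_rooted_coef m :
  gf_three_rooted m.+1 = m%:R *
  \sum_(a < m.+1.*2) \sum_(b < m.+1.*2) \sum_(c < m.+1.*2)
    (a.+1 * b.+1 * c.+1 * excess_compositions (a + b + c) m)%:R *
    (x1 ^+ a.+1 * x2 ^+ b.+1 * x3 ^+ c.+1).
Proof.
pose T d1 d2 d3 : {mpoly rat[3]} :=
  (num_three_rooted_trees m.+1 d1 d2 d3)%:R *: (x1 ^+ d1 * x2 ^+ d2 * x3 ^+ d3).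
have T0 d1 d2 d3 : (d1 * d2 * d3 = 0)%N -> T d1 d2 d3 = 0.
  by move=> d0; rewrite /T num_three_rooted_trees_deg0 // scale0r.
rewrite /gf_three_rooted [LHS]/=.
rewrite (sum_drop0 _ (F := fun d1 => \sum_(d2 < _) \sum_(d3 < _) T d1 d2 d3)).
  rewrite big_distrr; apply: eq_bigr => a _.
  rewrite (sum_drop0 _ (F := fun d2 => \sum_(d3 < _) T _ d2 d3)).
    rewrite big_distrr; apply: eq_bigr => b _.
    rewrite (sum_drop0 _ (F := T _ _)) ?T0 ?muln0 //.
    rewrite big_distrr; apply: eq_bigr => c _.
    rewrite /T num_three_rooted_treesE scaler_nat -mulnA -[LHS]mulr_natl.
    by rewrite [in LHS]natrM -mulrA.
  by rewrite big1 // => d3 _; rewrite T0 // muln0.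
by rewrite big1 // => d2 _; rewrite big1 // => d3 _; rewrite T0.
Qed.

Lemma mpoly_natU n : n.+1%:R \is a @GRing.unit {mpoly rat[3]}.
Proof.
rewrite -(rmorph_nat (@mpolyC 3 rat)) rmorph_unit // unitfE.
by rewrite Num.Theory.pnatr_eq0.
Qed.

Theorem mainTheorem8 (y : {fps {mpoly rat[3]}}) :
  let t : {fps {mpoly rat[3]}} := fpsX {mpoly rat[3]} in
  let X1 : {fps {mpoly rat[3]}} := x1%:S in
  let X2 : {fps {mpoly rat[3]}} := x2%:S in
  let X3 : {fps {mpoly rat[3]}} := x3%:S in
  y ^+ 2 = 1 - 4 * t ->
  y 0%N = 1 ->
  gf_three_rooted =
    (t ^+ 2 * X1 * X2 * X3 * (y + 1) ^+ 10)
      / (2 * y ^+ 3 * (1 + y - 2 * t * X1) ^+ 3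
                    * (1 + y - 2 * t * X2) ^+ 3
                    * (1 + y - 2 * t * X3) ^+ 3)
    * (1 - y
       + (2 * y - 2 * t) * (X1 + X2 + X3)
       + 1 / 2 * (y - 1) * (1 + 3 * y - 6 * t) * (X1 * X2 + X1 * X3 + X2 * X3)
       + 1 / 4 * (y - 1) ^+ 2 * (2 + 4 * y - 10 * t) * (X1 * X2 * X3)).
Proof.
move=> t X1 X2 X3 y_sqr y_0.
rewrite -(roots_series_rational mpoly_natU y_sqr y_0); try exact: fps_derivC.
apply/fpsP => -[|m]; rewrite expr2 -mulrA fps_coefXM.
  by rewrite /= !big_ord1 num_three_rooted_trees_lt2 // scale0r.
rewrite fps_coefX_deriv gf_three_rooted_coef; congr (_ * _).
by rewrite (roots_series_coef mpoly_natU y_sqr y_0 _ _ _ (N := m.+1.*2)) //; lia.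
Qed.
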